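(* Let $k\ge 1$ be an integer. Given a finite set of points $S$ in the plane and a pseudohalfplane arrangement $\mathcal H$, one can color $S$ with $k$ colors such that any pseudohalfplane in $\mathcal H$ that contains at least $2k-1$ points of $S$ contains points of all $k$ colors. Equivalently, the vertices $S$ of any finite pseudohalfplane-hypergraph can be colored with $k$ colors such that any hyperedge containing at least $2k-1$ vertices contains vertices of all $k$ colors.
   Context: A pseudoline arrangement is a finite collection of simple curves in the plane such that each curve cuts the plane into two components (both ends of each curve are at infinity), any two of the curves are either disjoint or intersect exactly once, and at the intersection point they cross; moreover the curves are in general position, i.e. no three of them have a common point. A pseudohalfplane arrangement is a pseudoline arrangement with a side of each pseudoline selected; the selected sides are the pseudohalfplanes. A hypergraph $\mathcal F$ with an ordered vertex set is ABA-free if it does not contain two hyperedges $A$ and $B$ for which there are three vertices $x<y<z$ such that $x,z\in A\setminus B$ and $y\in B\setminus A$. For a hypergraph $\mathcal F$ on vertex set $S$, write $\bar F=S\setminus F$ and $\bar{\mathcal F}=\{\bar F\mid F\in\mathcal F\}$. A hypergraph $\mathcal H$ on an ordered set $S$ is a pseudohalfplane-hypergraph if there exists an ABA-free hypergraph $\mathcal F$ on $S$ such that $\mathcal H\subset \mathcal F\cup\bar{\mathcal F}$. *)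

(* Defs.v *)
From HB Require Import structures.
From mathcomp Require Import all_boot all_order all_algebra.
From mathcomp Require Import all_classical all_reals all_analysis.

Set Implicit Arguments.
Unset Strict Implicit.
Unset Printing Implicit Defensive.

Import Order.TTheory GRing.Theory Num.Theory.
Import numFieldNormedType.Exports.

Local Open Scope classical_set_scope.
Local Open Scope card_scope.
Local Open Scope ring_scope.

Definition components (T : topologicalType) (U : set T) : set (set T) :=
  [set connected_component U x | x in U].

Section Geometry.
Variable R : realType.
Implicit Types (f g : R -> R * R) (p : R * R).

(* [components] of the complement of the curve: the sides are open, and the
   points of the curve itself lie on neither of them. *)
Definition sides f : set (set (R * R)) := components (~` range f).

Definition pseudoline f : Prop :=
  [/\ continuous f,
      injective f,
      `|f t| @[t --> +oo] --> +oo,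
      `|f t| @[t --> -oo] --> +oo
    & sides f #= `I_2].

(* At parameter [t], the curve [g] passes from one side of [f] to another. *)
Definition changes_side f g (t : R) : Prop :=
  exists A B : set (R * R),
    [/\ sides f A, sides f B, A <> B,
        \forall s \near t^'-, A (g s) & \forall s \near t^'+, B (g s)].

Definition cross_at f g p : Prop :=
  exists s t : R,
    [/\ f s = p, g t = p, changes_side f g t & changes_side g f s].

Definition pseudoline_arrangement (I : finType) (L : I -> R -> R * R) : Prop :=
  [/\ forall i, pseudoline (L i),
      forall i j, i != j ->
        range (L i) `&` range (L j) = set0 \/
        exists p, range (L i) `&` range (L j) = [set p] /\
                  cross_at (L i) (L j) p
    & forall i j l, i != j -> j != l -> i != l ->
        range (L i) `&` range (L j) `&` range (L l) = set0].

Definition pseudohalfplane_arrangement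
    (I : finType) (H : I -> set (R * R)) : Prop :=
  exists L : I -> R -> R * R,
    pseudoline_arrangement L /\ forall i, sides (L i) (H i).

End Geometry.

Section Hypergraphs.
Variables (d : Order.disp_t) (S : finOrderType d).
Implicit Types F H : {set {set S}}.

Definition ABA_free F : Prop :=
  ~ exists A B : {set S}, [/\ A \in F, B \in F &
      exists x y z : S, [/\ (x < y)%O, (y < z)%O,
        x \in A :\: B, z \in A :\: B & y \in B :\: A]].

Definition compl_hypergraph F : {set {set S}} := [set ~: A | A in F]%SET.

Definition pseudohalfplane_hypergraph H : Prop :=
  exists F, ABA_free F /\ H \subset F :|: compl_hypergraph F.

End Hypergraphs.

(* Main.v *)
Require Import Defs.
From HB Require Import structures.
From mathcomp Require Import all_boot all_order all_algebra.
From mathcomp Require Import zify.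

Set Implicit Arguments.
Unset Strict Implicit.
Unset Printing Implicit Defensive.

Import Order.TTheory GRing.Theory Num.Theory.

(** The geometric half is reduced to the hypergraph half, and the hypergraph
    half is proved by peeling off sparse hitting sets.

    Hypergraphs.  For [k+1] colours it is enough to find, for the
    inclusion-minimal hyperedges with at least [2k+1] vertices, a set of
    vertices that meets each of them in one or two vertices: that set receives
    a colour of its own, at least [2k-1] vertices remain in each of those
    hyperedges, and induction applies ([polychromatic_coloring]).  Think of the hyperedges in the ABA-free
    family as the points above a pseudoline, and of their complements as the
    points below.  A vertex that no hyperedge passes over lies on the upper
    hull of the point set, a vertex that no complement passes under lies on
    the lower hull.  Every hyperedge contains a hull vertex
    ([exists_unskipped]), so a minimal hitting set can be chosen on the hull.
    Among three of its vertices inside one hyperedge, the middle one in the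
    cyclic order of the hull has a hyperedge of its own, which is squeezed
    between the other two and would have to lie inside the given one
    ([no_three_hits]).

    Geometry.  The points have to be ordered so that the chosen sides, up to
    complements, are ABA-free.  If the pseudolines are oriented and linearly
    ordered in such a way that no two points show the sign patterns [+-+] and
    [-+-] on three pseudolines in that order, then sorting the points
    lexicographically by their sign vectors works
    ([lexicographic_ABA_free]).  For straight lines the right order is the
    order of slopes, that is, the order in which the lines are met along a
    circle at infinity.  The circle at infinity is replaced by a finite
    graph: its vertices are the sign vectors, and each of the two ends of
    each pseudoline is an edge, joining the two sign vectors found on both
    sides of that end.
    - The degrees are even ([even_incident]): on every pseudoline the points
      at which all other signs agree with a given vector form an interval, and
      the finite ends of these intervals, which are crossings, are counted
      twice.
    - The ends lie in one component ([ends_connected]), because the outside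
      of a large square is connected.
    Hence there is an Eulerian trail, and a trail passes from one side of a
    pseudoline to the other exactly at the two ends of that pseudoline: the
    order of the ends along the trail has the same separation properties as
    the order on a circle ([end_positions]).  Ordering the pseudolines by
    their first ends, the forbidden patterns are excluded ([no_zigzag]) since
    every cell of a sub-arrangement has a boundary point on one of its curves
    ([side_of_touched]), and the signs along each curve are known. *)

(** * The hull of an ABA-free hypergraph *)

Section Skipping.
Variables (T : finType).
Implicit Types (lt : rel T) (F : {set {set T}}) (A B M : {set T}).

(** Orders are plain relations here, so that they can be reversed and
    restricted to a part of the vertices. *)
Definition strict_total lt :=
  [/\ irreflexive lt, transitive lt & forall x y, x != y -> lt x y || lt y x].

Definition noABA lt F := forall A B x y z, A \in F -> B \in F ->
  lt x y -> lt y z -> x \in A -> x \notin B -> z \in A -> z \notin B ->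
  y \in B -> y \in A.

(** The upper hull of the vertices; its mirror image [unskipped_below] is the
    lower hull. *)
Definition unskipped lt F : {set T} :=
  [set v | [forall B in F, forall x in B, forall z in B,
              lt x v ==> lt v z ==> (v \in B)]].

Definition unskipped_below lt F : {set T} :=
  [set v | [forall B in F, forall x in ~: B, forall z in ~: B,
              lt x v ==> lt v z ==> (v \notin B)]].

Lemma unskippedP lt F v :
  reflect (forall B x z, B \in F -> lt x v -> lt v z -> x \in B -> z \in B ->
           v \in B) (v \in unskipped lt F).
Proof.
rewrite inE; apply: (iffP forall_inP) => [h B x z BF xv vz xB zB|h B BF].
  by move: (h B BF) => /forall_inP/(_ x xB)/forall_inP/(_ z zB); rewrite xv vz.
apply/forall_inP => x xB; apply/forall_inP => z zB.
by apply/implyP => xv; apply/implyP => vz; apply: h BF xv vz xB zB.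
Qed.

Lemma unskipped_belowP lt F v :
  reflect (forall B x z, B \in F -> lt x v -> lt v z -> x \notin B ->
           z \notin B -> v \notin B) (v \in unskipped_below lt F).
Proof.
rewrite inE; apply: (iffP forall_inP) => [h B x z BF xv vz xB zB|h B BF].
  move: (h B BF) => /forall_inP/(_ x)/[!inE]/(_ xB)/forall_inP/(_ z)/[!inE].
  by move=> /(_ zB); rewrite xv vz.
apply/forall_inP => x /[!inE] xB; apply/forall_inP => z /[!inE] zB.
by apply/implyP => xv; apply/implyP => vz; apply: h BF xv vz xB zB.
Qed.

Definition complements F : {set {set T}} := [set ~: A | A in F].

Lemma complementsE F A : (A \in complements F) = (~: A \in F).
Proof.
apply/imsetP/idP => [[B BF ->]|AF]; first by rewrite setCK.
by exists (~: A) => //; rewrite setCK.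
Qed.

Lemma complementsK F : complements (complements F) = F.
Proof. by apply/setP => A; rewrite !complementsE setCK. Qed.

Lemma noABA_complements lt F : noABA lt F -> noABA lt (complements F).
Proof.
move=> h A B x y z; rewrite !complementsE => AF BF xy yz xA xB zA zB yB.
apply/negPn/negP => yA.
have := h _ _ x y z BF AF xy yz; rewrite !inE.
by rewrite xA xB zA zB yA yB => /(_ isT isT isT isT isT).
Qed.

Lemma unskipped_complements lt F :
  unskipped lt (complements F) = unskipped_below lt F.
Proof.
apply/setP => v; apply/unskippedP/unskipped_belowP => h B x z BF xv vz xB zB.
  by have := h (~: B) x z; rewrite complementsE setCK !inE; apply.
by have := h (~: B) x z; rewrite -complementsE !inE !negbK; apply.
Qed.

Lemma unskipped_below_complements lt F :
  unskipped_below lt (complements F) = unskipped lt F.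
Proof. by rewrite -unskipped_complements complementsK. Qed.

Definition converse lt : rel T := fun x y => lt y x.

Lemma strict_total_converse lt : strict_total lt -> strict_total (converse lt).
Proof.
case=> irr tr tot; split=> [x|y x z xy yz|x y xy]; first exact: irr.
  exact: tr yz xy.
by rewrite /converse orbC tot.
Qed.

Lemma noABA_converse lt F : noABA lt F -> noABA (converse lt) F.
Proof.
move=> h A B x y z AF BF xy yz xA xB zA zB yB.
exact: (h A B z y x).
Qed.

Lemma unskipped_converse lt F : unskipped (converse lt) F = unskipped lt F.
Proof.
apply/setP => v; apply/unskippedP/unskippedP => h B x z BF xv vz xB zB.
  exact: (h B z x).
exact: (h B z x).
Qed.

Lemma unskipped_below_converse lt F :
  unskipped_below (converse lt) F = unskipped_below lt F.
Proof. by rewrite -!unskipped_complements unskipped_converse. Qed.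

Section Order.
Variables (lt : rel T) (F : {set {set T}}).
Hypotheses (ltS : strict_total lt) (F_ABA : noABA lt F).

Let irr x : lt x x = false. Proof. by case: ltS. Qed.
Let tr x y z : lt x y -> lt y z -> lt x z. Proof. by case: ltS => _ t _; apply: t. Qed.
Let tot x y : [\/ x = y, lt x y | lt y x].
Proof.
case: ltS => _ _ /(_ x y); case: eqP => [-> _|_ /(_ isT) /orP[]]; by constructor.
Qed.

Lemma exists_last (P : pred T) x0 :
  P x0 -> exists2 x, P x & forall y, P y -> ~~ lt x y.
Proof.
move=> Px0; case: (arg_maxnP (fun x => #|[pred y | lt y x]|) Px0) => x Px xmax.
exists x => // y /xmax; apply: contraL => xy; rewrite -ltnNge; apply: proper_card.
apply/properP; split; first by apply/subsetP => z; rewrite !inE => /tr; apply.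
by exists x; rewrite !inE ?irr.
Qed.

(** If every vertex of [A] were passed over, call a vertex right-skipped when
    some hyperedge passes over it and stays inside [A] to the right of it.
    The last vertex of [A] is not right-skipped.  At the first such vertex
    [w], a hyperedge [C] over [w] leaves [A] to the right, hence stays in [A]
    to the left; the last vertex [y] of [C] before [w] is right-skipped by
    some [B], and [B] and [C] then alternate. *)
Lemma exists_unskipped A : A \in F -> A != set0 ->
  exists2 v, v \in A & v \in unskipped lt F.
Proof.
move=> AF /set0Pn[a0 a0A].
have [/existsP[v /andP[vA vU]]|/existsPn nU] :=
  boolP [exists v, (v \in A) && (v \in unskipped lt F)]; first by exists v.
have {nU}skip v : v \in A -> exists B x z, [/\ B \in F, lt x v & lt v z] /\
    [/\ x \in B, z \in B & v \notin B].
  move=> vA; have := nU v; rewrite vA inE /= => /forall_inPn[B BF].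
  case/forall_inPn => x xB /forall_inPn[z zB].
  by rewrite !negb_imply => /and3P[xv vz vB]; exists B, x, z.
pose rt v := [exists B in F, [&& v \notin B, [exists x in B, lt x v],
  [exists z in B, lt v z] & [forall z in B, lt v z ==> (z \in A)]]].
have rtI v B x z : B \in F -> v \notin B -> x \in B -> lt x v -> z \in B ->
    lt v z -> (forall z', z' \in B -> lt v z' -> z' \in A) -> rt v.
  move=> BF vB xB xv zB vz h; apply/existsP; exists B; rewrite BF vB /=.
  apply/and3P; split; [by apply/existsP; exists x; rewrite xB| |].
    by apply/existsP; exists z; rewrite zB.
  by apply/forall_inP => z' z'B; apply/implyP; apply: h.
have [m mA mlast] : exists2 m, m \in A & forall y, y \in A -> ~~ lt m y.
  exact: exists_last a0A.
have mNrt : ~~ rt m.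
  apply/negP => /exists_inP[B _ /and4P[_ _ /exists_inP[z zB mz]]].
  by move=> /forall_inP/(_ z zB); rewrite mz => /mlast; rewrite mz.
have [w /andP[wA wNrt] wfirst] : exists2 w, (w \in A) && ~~ rt w &
    forall y, (y \in A) && ~~ rt y -> ~~ lt y w.
  have mP : (m \in A) && ~~ rt m by rewrite mA.
  case: (arg_minnP (P := fun w => (w \in A) && ~~ rt w)
    (fun x => #|[pred y | lt y x]|) mP) => w wP wmin.
  exists w => // y /wmin; apply: contraL => yw; rewrite -ltnNge.
  apply: proper_card; apply/properP.
  split; first by apply/subsetP => z; rewrite !inE => /tr; apply.
  by exists y; rewrite !inE ?irr.
have [C [y0 [u0 [[CF y0w wu0] [y0C u0C wC]]]]] := skip w wA.
have [/forall_inP hA|] := boolP [forall z in C, lt w z ==> (z \in A)].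
  case/negP: wNrt; apply: (rtI w C y0 u0) => // z' z'C.
  by apply/implyP; apply: hA.
case/forall_inPn => u uC; rewrite negb_imply => /andP[wu uA].
have CA y : y \in C -> lt y w -> y \in A.
  move=> yC yw; apply/negPn/negP => yA; move/negP: wC; apply.
  exact: (F_ABA (A := C) (B := A) (x := y) (z := u)).
have [y /andP[yC yw] ylast] :=
  exists_last (P := fun y => (y \in C) && lt y w) (introT andP (conj y0C y0w)).
have yA := CA y yC yw.
have yrt : rt y.
  by have := wfirst y; rewrite yA yw; case: (rt y) => // /(_ isT).
case/exists_inP: yrt => B BF /and4P[yB /exists_inP[x xB xy] /exists_inP[z zB yz] /forall_inP hB].
have yu : lt y u := tr yw wu.
have uB : u \notin B by apply/negP => uB; move: (hB u uB); rewrite yu /= (negbTE uA).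
have key t : t \in B -> lt y t -> lt t u -> t \in C.
  move=> tB yt tu; exact: (F_ABA (A := C) (B := B) (x := y) (z := u)).
have wB : w \notin B by apply: contra wC => wB; apply: key.
case: (tot z w) => [zw|zw|wz].
- by move: wB; rewrite -zw zB.
- have := ylast z; rewrite (key z zB yz (tr zw wu)) zw yz => /(_ isT); by [].
- case/negP: wNrt; apply: (rtI w B x z) => //; first exact: tr yw.
  by move=> t tB wt; have := hB t tB; rewrite (tr yw wt).
Qed.

Section Three.
Variable M : {set T}.
Hypothesis MF : M \in F.

(** The separating hyperedge is [B] or the complement of [B]; the vertex [q]
    shows that it is not included in [M]. *)
Definition private x y z := exists B q, [/\ B \in F, q \notin M &
  [/\ x \in B, y \notin B, z \notin B & q \in B] \/
  [/\ x \notin B, y \in B, z \in B & q \notin B]].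

(* A lower hull vertex of [M] has all vertices on its left, or all vertices on
   its right, in [M]: otherwise the complement of [M] passes under it. *)
Let top x := x \in M /\ x \in unskipped lt F.
Let left x := [/\ x \in M, x \in unskipped_below lt F & forall y, lt y x -> y \in M].
Let right x := [/\ x \in M, x \in unskipped_below lt F & forall y, lt x y -> y \in M].

Let notleft x q : left x -> q \notin M -> lt x q.
Proof.
case=> xM _ h qM; case: (tot x q) => [xq|//|/h]; last by rewrite (negbTE qM).
by rewrite -xq xM in qM.
Qed.
Let notright x q : right x -> q \notin M -> lt q x.
Proof.
case=> xM _ h qM; case: (tot x q) => [xq|/h|//]; last by rewrite (negbTE qM).
by rewrite -xq xM in qM.
Qed.

Let noMBM x q z B : B \in F -> q \in B -> q \notin M -> x \in M -> x \notin B ->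
  z \in M -> z \notin B -> lt x q -> lt q z -> False.
Proof.
move=> BF qB qM xM xB zM zB xq qz; move/negP: qM; apply.
exact: (F_ABA (A := M) (B := B) (x := x) (z := z)).
Qed.

(** In the next six lemmas, [private] is assumed for the vertex that lies
    between the other two in the order of the hull that runs through
    the left vertices backwards, the top vertices forwards and the right
    vertices backwards. *)
Lemma not_left3 x y z : left x -> left y -> left z -> lt x y -> lt y z ->
  private y x z -> False.
Proof.
move=> [xM /unskipped_belowP xU _] [yM /unskipped_belowP yU _] Lz xy yz.
case=> B [q [BF qM [[yB xB zB qB]|[yB xB zB qB]]]].
  by have := yU B x z BF xy yz xB zB; rewrite yB.
have [zM /unskipped_belowP zU _] := Lz.
by have := zU B y q BF yz (notleft Lz qM) yB qB; rewrite zB.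
Qed.

Lemma not_left2_top x y c : left x -> left y -> top c -> lt x y ->
  private x y c -> False.
Proof.
move=> [xM /unskipped_belowP xU _] Ly [cM /unskippedP cU] xy.
have [yM /unskipped_belowP yU _] := Ly.
case=> B [q [BF qM [[xB yB cB qB]|[xB yB cB qB]]]]; have yq := notleft Ly qM; last first.
  by have := yU B x q BF xy yq xB qB; rewrite yB.
have xq := tr xy yq.
have [cq|cq|qc] := tot c q; first by rewrite cq qB in cB.
  have [cx|cx|xc] := tot c x; first by rewrite cx xB in cB.
    by have := xU B c y BF cx xy cB yB; rewrite xB.
  by have := cU B x q BF xc cq xB qB; rewrite (negbTE cB).
exact: (noMBM BF qB qM yM yB cM cB yq qc).
Qed.

Lemma not_left2_right x y c : left x -> left y -> right c -> lt x y ->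
  private x y c -> False.
Proof.
move=> Lx Ly Rc xy; have [cM _ _] := Rc.
have [yM /unskipped_belowP yU _] := Ly.
case=> B [q [BF qM [[xB yB cB qB]|[xB yB cB qB]]]]; have yq := notleft Ly qM; last first.
  by have := yU B x q BF xy yq xB qB; rewrite yB.
exact: (noMBM BF qB qM yM yB cM cB yq (notright Rc qM)).
Qed.

Lemma not_left_top2 x c d : left x -> top c -> top d -> lt c d ->
  private c x d -> False.
Proof.
move=> Lx [cM /unskippedP cU] [dM /unskippedP dU] cd.
have [xM /unskipped_belowP xU _] := Lx.
case=> B [q [BF qM [[cB xB dB qB]|[cB xB dB qB]]]]; have xq := notleft Lx qM.
  have [dq|dq|qd] := tot d q; first by rewrite dq qB in dB.
    by have := dU B c q BF cd dq cB qB; rewrite (negbTE dB).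
  exact: (noMBM BF qB qM xM xB dM dB xq qd).
have [cx|cx|xc] := tot c x; first by rewrite cx xB in cB.
  by have := xU B c q BF cx xq cB qB; rewrite xB.
by have := cU B x d BF xc cd xB dB; rewrite (negbTE cB).
Qed.

Lemma not_left_top_right x c z : left x -> top c -> right z ->
  private c x z -> False.
Proof.
move=> Lx [cM /unskippedP cU] Rz.
have [xM /unskipped_belowP xU _] := Lx.
have [zM /unskipped_belowP zU _] := Rz.
case=> B [q [BF qM [[cB xB zB qB]|[cB xB zB qB]]]];
  have xq := notleft Lx qM; have qz := notright Rz qM.
  exact: (noMBM BF qB qM xM xB zM zB xq qz).
have [cx|cx|xc] := tot c x; first by rewrite cx xB in cB.
  by have := xU B c q BF cx xq cB qB; rewrite xB.
have [cz|cz|zc] := tot c z; first by rewrite cz zB in cB.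
  by have := cU B x z BF xc cz xB zB; rewrite (negbTE cB).
by have := zU B q c BF qz zc qB cB; rewrite zB.
Qed.

Lemma not_top3 a b c : top a -> top b -> top c -> lt a b -> lt b c ->
  private b a c -> False.
Proof.
move=> [aM /unskippedP aU] [bM /unskippedP bU] [cM /unskippedP cU] ab bc.
case=> B [q [BF qM [[bB aB cB qB]|[bB aB cB qB]]]]; last first.
  by have := bU B a c BF ab bc aB cB; rewrite (negbTE bB).
have [qa|qa|aq] := tot q a; first by rewrite -qa qB in aB.
  by have := aU B q b BF qa ab qB bB; rewrite (negbTE aB).
have [qc|qc|cq] := tot q c; first by rewrite -qc qB in cB.
  exact: (noMBM BF qB qM aM aB cM cB aq qc).
by have := cU B b q BF bc cq bB qB; rewrite (negbTE cB).
Qed.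

Lemma hull_types x : x \in M -> x \in unskipped lt F :|: unskipped_below lt F ->
  [\/ top x, left x | right x].
Proof.
move=> xM; rewrite inE => /orP[xU|xU]; first by constructor 1.
have [/forallP h|/forallPn[y]] := boolP [forall y, lt y x ==> (y \in M)].
  by constructor 2; split=> // y; apply/implyP; apply: h.
rewrite negb_imply => /andP[yx yM]; constructor 3; split=> // z xz.
apply/negPn/negP => zM; move/unskipped_belowP: xU => /(_ M y z MF yx xz yM zM).
by rewrite xM.
Qed.

End Three.
End Order.

Lemma private_swap F M x y z : private F M x y z -> private F M x z y.
Proof.
case=> B [q [BF qM h]]; exists B, q; split=> //.
by case: h => -[]; [left|right].
Qed.

(** The mirror images of the six configurations are the same configurations
    for the reversed order. *)
Lemma no_three_hits lt F M a b c : strict_total lt -> noABA lt F -> M \in F ->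
  a \in M -> b \in M -> c \in M ->
  [set a; b; c] \subset unskipped lt F :|: unskipped_below lt F ->
  lt a b -> lt b c ->
  private F M a b c -> private F M b a c -> private F M c a b -> False.
Proof.
move=> ltS FA MF aM bM cM /subsetP hull ab bc pa pb pc.
have ac : lt a c by case: ltS => _ t _; exact: t ab bc.
have cS := strict_total_converse ltS; have cA := noABA_converse FA.
have pa' := private_swap pa; have pb' := private_swap pb; have pc' := private_swap pc.
have typ x : x \in [set a; b; c] -> x \in M -> _ := fun xs xM => hull_types MF xM (hull x xs).
have sa : a \in [set a; b; c] by rewrite !inE eqxx.
have sb : b \in [set a; b; c] by rewrite !inE eqxx orbT.
have sc : c \in [set a; b; c] by rewrite !inE eqxx !orbT.
have trev x : x \in M /\ x \in unskipped lt F ->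
    x \in M /\ x \in unskipped (converse lt) F by rewrite unskipped_converse.
have lrev x : [/\ x \in M, x \in unskipped_below lt F & forall y, lt y x -> y \in M] ->
 [/\ x \in M, x \in unskipped_below (converse lt) F & forall y, converse lt x y -> y \in M]
  by rewrite unskipped_below_converse.
have rrev x : [/\ x \in M, x \in unskipped_below lt F & forall y, lt x y -> y \in M] ->
 [/\ x \in M, x \in unskipped_below (converse lt) F & forall y, converse lt y x -> y \in M]
  by rewrite unskipped_below_converse.
have l3 := not_left3 ltS; have r3 := not_left3 cS.
have llt := not_left2_top ltS FA MF; have rrt := not_left2_top cS cA MF.
have llr := not_left2_right ltS FA MF; have rrl := not_left2_right cS cA MF.
have ltt := not_left_top2 ltS FA MF; have rtt := not_left_top2 cS cA MF.
have ltr := not_left_top_right ltS FA MF.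
have t3 := not_top3 ltS FA MF.
move: (typ c sc cM) (typ b sb bM) (typ a sa aM).
move=> [tc|Lc|Rc] [tb|Lb|Rb] [ta|La|Ra].
- exact: (t3 _ _ _ ta tb tc ab bc pb).
- exact: (ltt _ _ _ La tb tc bc pb).
- exact: (rtt _ _ _ (rrev _ Ra) (trev _ tc) (trev _ tb) bc pc).
- exact: (ltt _ _ _ Lb ta tc ac pa).
- exact: (llt _ _ _ La Lb tc ab pa).
- exact: (ltr _ _ _ Lb tc Ra pc').
- exact: (rtt _ _ _ (rrev _ Rb) (trev _ tc) (trev _ ta) ac pc').
- exact: (ltr _ _ _ La tc Rb pc).
- exact: (rrt _ _ _ (rrev _ Rb) (rrev _ Ra) (trev _ tc) ab pb).
- exact: (ltt _ _ _ Lc ta tb ab pa').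
- exact: (llt _ _ _ La Lc tb ac pa').
- exact: (ltr _ _ _ Lc tb Ra pb').
- exact: (llt _ _ _ Lb Lc ta bc pb').
- exact: (l3 _ _ _ _ _ La Lb Lc ab bc pb).
- exact: (llr _ _ _ Lb Lc Ra bc pb').
- exact: (ltr _ _ _ Lc ta Rb pa').
- exact: (llr _ _ _ La Lc Rb ac pa').
- exact: (rrl _ _ _ (rrev _ Rb) (rrev _ Ra) (lrev _ Lc) ab pb).
- exact: (rtt _ _ _ (rrev _ Rc) (trev _ tb) (trev _ ta) ab pb').
- exact: (ltr _ _ _ La tb Rc pb).
- exact: (rrt _ _ _ (rrev _ Rc) (rrev _ Ra) (trev _ tb) ac pc).
- exact: (ltr _ _ _ Lb ta Rc pa).
- exact: (llr _ _ _ La Lb Rc ab pa).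
- exact: (rrl _ _ _ (rrev _ Rc) (rrev _ Ra) (lrev _ Lb) ac pc).
- exact: (rrt _ _ _ (rrev _ Rc) (rrev _ Rb) (trev _ ta) bc pc').
- exact: (rrl _ _ _ (rrev _ Rc) (rrev _ Rb) (lrev _ La) bc pc').
- exact: (r3 _ _ _ _ _ (rrev _ Rc) (rrev _ Rb) (rrev _ Ra) bc ab pb').
Qed.

End Skipping.

(** * Sparse hitting sets and polychromatic colourings *)

Section HittingSet.
Variable T : finType.
Implicit Types (lt : rel T) (F E : {set {set T}}) (A B M N P : {set T}).

Lemma private_of_edge F M N x y z q :
  N \in F :|: complements F -> q \in N -> q \notin M ->
  x \in N -> y \notin N -> z \notin N -> private F M x y z.
Proof.
rewrite inE complementsE => /orP[NF|NF] qN qM xN yN zN.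
  by exists N, q; split=> //; left.
by exists (~: N), q; split=> //; right; rewrite !inE xN yN zN qN.
Qed.

Lemma edge_hull lt F M : strict_total lt -> noABA lt F ->
  M \in F :|: complements F -> M != set0 ->
  exists2 v, v \in M & v \in unskipped lt F :|: unskipped_below lt F.
Proof.
move=> ltS FA /setUP[MF|MF] M0.
  have [v vM vU] := exists_unskipped ltS FA MF M0.
  by exists v; rewrite // inE vU.
have [v vM vU] := exists_unskipped ltS (noABA_complements FA) MF M0.
by exists v; rewrite // inE -unskipped_complements vU orbT.
Qed.

(** By minimality every vertex of a minimal hitting set has a hyperedge which
    it alone hits; in an antichain this hyperedge is not included in [M]. *)
Lemma shallow_hitting_set lt F E : strict_total lt -> noABA lt F ->
  E \subset F :|: complements F ->
  {in E, forall M, M != set0} ->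
  {in E &, forall M N, M \subset N -> M = N} ->
  exists P, {in E, forall M, P :&: M != set0 /\ (#|M :&: P| <= 2)%N}.
Proof.
move=> ltS FA /subsetP EF E0 anti.
pose hits P := [forall M in E, P :&: M != set0].
have hull_hits : hits (unskipped lt F :|: unskipped_below lt F).
  apply/forall_inP => M ME; have [v vM vU] := edge_hull ltS FA (EF M ME) (E0 M ME).
  by apply/set0Pn; exists v; rewrite inE vM andbT.
have [P /minsetP[hitP minP] /subsetP Phull] := minset_exists hull_hits.
exists P => M ME; split; first exact: (forall_inP hitP).
have own x : x \in P -> exists2 N : {set T}, N \in E & forall y, y \in P -> (y \in N) = (y == x).
  move=> xP; have /forall_inPn[N NE] : ~~ hits (P :\ x).
    apply: contraL xP => /minP/(_ (subsetDl _ _)) <-.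
    by rewrite !inE eqxx.
  rewrite negbK => /eqP PN; exists N => // y yP.
  have out z : z \in P -> z != x -> z \notin N.
    by move=> zP zx; apply/negP => zN; have := in_set0 z; rewrite -PN !inE zx zP zN.
  have [->|yx] := eqVneq y x; last exact/negbTE/out.
  have /set0Pn[z /setIP[zP zN]] := forall_inP hitP N NE.
  by have [<-//|zx] := eqVneq z x; rewrite (negbTE (out z zP zx)) in zN.
have priv x y z : x \in P -> y \in P -> z \in P -> y \in M -> x != y -> x != z ->
   exists (N : {set T}) q, [/\ N \in F :|: complements F, q \in N & q \notin M] /\
     [/\ x \in N, y \notin N & z \notin N].
  move=> xP yP zP yM xy xz; have [N NE NP] := own x xP.
  have [q qN qM] : exists2 q, q \in N & q \notin M.
    apply/subsetPn/negP => /(anti N M NE ME) NM.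
    by rewrite -NM NP // eq_sym (negbTE xy) in yM.
  by exists N, q; split; split=> //; rewrite ?EF // !NP // 1?eq_sym //.
rewrite leqNgt; apply/negP => /card_gt2P[a [b [c [[/setIP[aM aP] /setIP[bM bP] /setIP[cM cP]]]]]].
have [_ _ tot] := ltS; have irr x : lt x x = false by case: ltS.
have sorted x y z : x \in M -> y \in M -> z \in M -> x \in P -> y \in P -> z \in P ->
    lt x y -> lt y z -> False.
  move=> xM yM zM xP yP zP xy yz; have xz : lt x z by case: ltS => _ t _; exact: t xy yz.
  have neq u v : lt u v -> (u != v) && (v != u).
    by move=> uv; rewrite eq_sym andbb; apply: contraTneq uv => ->; rewrite irr.
  have /andP[nxy nyx] := neq _ _ xy; have /andP[nyz nzy] := neq _ _ yz.
  have /andP[nxz nzx] := neq _ _ xz.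
  have [N1 [q1 [[N1F q1N q1M] [? ? ?]]]] := priv x y z xP yP zP yM nxy nxz.
  have [N2 [q2 [[N2F q2N q2M] [? ? ?]]]] := priv y x z yP xP zP xM nyx nyz.
  have [N3 [q3 [[N3F q3N q3M] [? ? ?]]]] := priv z x y zP xP yP xM nzx nzy.
  have sub : [set x; y; z] \subset unskipped lt F :|: unskipped_below lt F.
    apply/subsetP => u; rewrite !inE -orbA => /or3P[] /eqP->.
    - by have := Phull x xP; rewrite !inE.
    - by have := Phull y yP; rewrite !inE.
    - by have := Phull z zP; rewrite !inE.
  have /setUP[MF|MF] := EF M ME.
    apply: (no_three_hits ltS FA MF xM yM zM sub xy yz).
    - by apply: (private_of_edge N1F q1N q1M).
    - by apply: (private_of_edge N2F q2N q2M).
    - by apply: (private_of_edge N3F q3N q3M).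
  have comp N : N \in F :|: complements F -> N \in complements F :|: complements (complements F).
    by rewrite complementsK setUC.
  rewrite (setUC (unskipped _ _)) -unskipped_complements -(unskipped_below_complements lt F) in sub.
  apply: (no_three_hits ltS (noABA_complements FA) MF xM yM zM sub xy yz).
  - by apply: (private_of_edge (comp _ N1F) q1N q1M).
  - by apply: (private_of_edge (comp _ N2F) q2N q2M).
  - by apply: (private_of_edge (comp _ N3F) q3N q3M).
case=> /tot ab /tot bc /tot ca.
case/orP: ab => ab; case/orP: bc => bc; case/orP: ca => ca.
- exact: (sorted a b c).
- exact: (sorted a b c).
- exact: (sorted c a b).
- exact: (sorted a c b).
- exact: (sorted b c a).
- exact: (sorted b a c).
- exact: (sorted c b a).
- exact: (sorted c b a).
Qed.

End HittingSet.

Lemma noABA_restrict (T : finType) (lt : rel T) (F : {set {set T}}) (Q : pred T) :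
  noABA lt F ->
  noABA (relpre val lt) [set [set x : {x | Q x} | val x \in A] | A : {set T} in F].
Proof.
move=> FA _ _ x y z /imsetP[A AF ->] /imsetP[B BF ->] xy yz; rewrite !inE.
exact: FA AF BF xy yz.
Qed.

Lemma strict_total_restrict (T : finType) (lt : rel T) (Q : pred T) :
  strict_total lt -> strict_total (relpre (val : {x | Q x} -> T) lt).
Proof.
case=> irr tr tot; split=> [x|y x z|x y]; [exact: irr|exact: tr|].
by rewrite -val_eqE; apply: tot.
Qed.

(** There are [k + 1] colours here, so the bound is [2 (k + 1) - 1].  Only the
    minimal large hyperedges matter, and they form an antichain; the hitting
    set takes at most two vertices from each of them. *)
Theorem polychromatic_coloring k (T : finType) (lt : rel T) (F : {set {set T}}) :
  strict_total lt -> noABA lt F ->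
  exists c : T -> nat, forall A, A \in F :|: complements F ->
    (2 * k < #|A|)%N -> forall i, (i <= k)%N -> exists2 x, x \in A & c x = i.
Proof.
elim: k T lt F => [|k IH] T lt F ltS FA.
  exists (fun=> 0%N) => A _ /card_gt0P[x xA] [|//] _; by exists x.
pose E := [set A in F :|: complements F | (2 * k.+1 < #|A|)%N].
pose Emin := [set A in E | [forall B in E, (B \subset A) ==> (B == A)]].
have EminE A : A \in Emin -> A \in F :|: complements F /\ (2 * k.+1 < #|A|)%N.
  by rewrite inE => /andP[/setIdP[]].
have [P hit] : exists P, {in Emin, forall M, P :&: M != set0 /\ (#|M :&: P| <= 2)%N}.
  apply: (shallow_hitting_set ltS FA).
  - by apply/subsetP => A /EminE[].
  - by move=> A /EminE[_ A0]; rewrite -card_gt0; apply: leq_ltn_trans A0.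
  - move=> M N /setIdP[ME _] /setIdP[_ /forall_inP/(_ M ME)].
    by move=> /implyP h /h/eqP.
pose T' : finType := {x | x \notin P}.
have [c chit] := IH T' _ _ (strict_total_restrict _ ltS) (noABA_restrict FA).
exists (fun x => if insub x is Some y then c y else k.+1) => A AF Abig i ik.
have [M ME MA] : exists2 M, M \in Emin & M \subset A.
  have AE : A \in E by rewrite inE AF.
  have [M /minsetP[ME Mmin] MA] := minset_exists AE.
  have ME0 : M \in E := ME.
  exists M => //; rewrite inE ME0; apply/forall_inP => B BE; apply/implyP => BM.
  by apply/eqP/Mmin.
have [MF Mbig] := EminE M ME; have [/set0Pn[p /setIP[pP pM]] few] := hit M ME.
move: ik; rewrite leq_eqVlt => /orP[/eqP->|ik].
  by exists p; rewrite ?(subsetP MA) // insubN // negbK.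
have [] := chit [set x : T' | val x \in M] _ _ i ik.
- case/setUP: MF => [MF|]; rewrite inE; first by rewrite imset_f.
  rewrite !complementsE => MF; apply/orP; right; apply/imsetP; exists (~: M) => //.
  by apply/setP => x; rewrite !inE.
- have -> : #|[set x : T' | val x \in M]| = #|M :\: P|.
    rewrite -(card_imset _ val_inj); apply: eq_card => x; rewrite inE.
    apply/imsetP/andP => [[y + ->]|[xP xM]]; first by rewrite inE (valP y).
    by exists (Sub x xP : T'); rewrite ?inE.
  by have := cardsID P M; lia.
- by move=> x; rewrite inE => xM cx; exists (val x); rewrite ?(subsetP MA) // valK.
Qed.

(** * Eulerian trails *)

Section EulerTrail.
(* A multigraph: [flip e] exchanges the two endpoints of the edge [e]. *)
Variables (V E : finType) (inc : V -> E -> bool) (flip : E -> V -> V).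
Hypothesis flip_inc : forall v e, inc v e -> inc (flip e v) e.
Hypothesis flip_neq : forall v e, flip e v != v.
Hypothesis inc_two : forall v w e, inc v e -> inc w e -> w = v \/ w = flip e v.
Hypothesis inc_some : forall e, exists v, inc v e.
Hypothesis even_degree : forall v, ~~ odd #|[pred e | inc v e]|.
Hypothesis connected_graph : forall C : {set V},
  (forall v e, inc v e -> v \in C -> flip e v \in C) ->
  forall v e w f, inc v e -> inc w f -> v \in C -> w \in C.

Fixpoint trail v es :=
  if es is e :: es' then inc v e && trail (flip e v) es' else true.

Definition trail_end v es := foldl (fun u e => flip e u) v es.

Lemma trail_cat v es1 es2 :
  trail v (es1 ++ es2) = trail v es1 && trail (trail_end v es1) es2.
Proof. by elim: es1 v => //= e es IH v; rewrite IH andbA. Qed.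

Lemma trail_end_cat v es1 es2 :
  trail_end v (es1 ++ es2) = trail_end (trail_end v es1) es2.
Proof. exact: foldl_cat. Qed.

Lemma trail_parity v es u : trail v es ->
  odd (count (inc u) es) = (u == v) (+) (u == trail_end v es).
Proof.
elim: es v => [|e es IH] v /=; first by rewrite addbb.
case/andP=> ve tr; rewrite oddD (IH _ tr) addbA; congr (_ (+) _).
have -> : inc u e = (u == v) || (u == flip e v).
  apply/idP/idP => [ue|/orP[]/eqP-> //]; last exact: flip_inc.
  by case: (inc_two ve ue) => ->; rewrite eqxx ?orbT.
case: (eqVneq u v) => [->|_]; last by case: (_ == _).
by rewrite eq_sym (negbTE (flip_neq _ _)).
Qed.

Lemma trail_visit v es u e : trail v es -> e \in es -> inc u e ->
  exists es1 es2, es = es1 ++ es2 /\ u = trail_end v es1.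
Proof.
elim: es v => //= f es IH v /andP[vf tr]; rewrite inE => /orP[/eqP->|ein] ue.
  case: (inc_two vf ue) => ->; first by exists [::], (f :: es).
  by exists [:: f], es.
by have [es1 [es2 [-> ->]]] := IH _ tr ein ue; exists (f :: es1), es2.
Qed.

(** A trail that cannot be prolonged is closed, by parity; if it misses an
    edge, connectedness yields a missed edge at a visited vertex, and the
    trail can be started there instead. *)
Lemma trail_extend v es : trail v es -> uniq es ->
  (forall e, e \in es) \/
  exists v' es', [/\ trail v' es', uniq es' & (size es < size es')%N].
Proof.
move=> tr un; have [/forallP all_in|/forallPn[e0 e0es]] := boolP [forall e, e \in es].
  by left.
right; have [/existsP[e /andP[we ees]]|/existsPn full] :=
  boolP [exists e, inc (trail_end v es) e && (e \notin es)].
  exists v, (rcons es e); split; last by rewrite size_rcons.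
    by rewrite -cats1 trail_cat tr /= we.
  by rewrite rcons_uniq ees un.
have closed : trail_end v es = v.
  have := trail_parity (trail_end v es) tr; rewrite eqxx addbT.
  suff -> : count (inc (trail_end v es)) es = #|[pred e | inc (trail_end v es) e]|.
    by rewrite (negbTE (even_degree _)) => /esym/negbFE/eqP.
  rewrite -size_filter -(card_uniqP (filter_uniq _ un)); apply: eq_card => e.
  rewrite mem_filter inE; have := full e; rewrite negb_and negbK.
  by case: (inc _ e) => //= ->.
pose C := [set u | (u == v) || [exists e in es, inc u e]].
have [/existsP[u /existsP[e /and3P[uC ue ees]]]|/existsPn noexit] :=
  boolP [exists u, exists e, [&& u \in C, inc u e & e \notin es]].
  have [es1 [es2 [esE uE]]] : exists es1 es2, es = es1 ++ es2 /\ u = trail_end v es1.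
    move: uC; rewrite inE => /orP[/eqP->|/exists_inP[f fes uf]]; first by exists [::], es.
    exact: trail_visit fes uf.
  exists u, (rcons (es2 ++ es1) e); rewrite esE in tr un closed ees *.
  move: tr closed; rewrite trail_cat trail_end_cat -uE => /andP[tr1 tr2] closed.
  split; last by rewrite size_rcons !size_cat addnC.
    by rewrite -cats1 !trail_cat tr2 closed tr1 trail_end_cat closed -uE /= ue.
  by rewrite rcons_uniq uniq_catC un andbT !mem_cat orbC -mem_cat.
have stay u e : u \in C -> inc u e -> e \in es.
  move=> uC ue; have /existsPn/(_ e) := noexit u.
  by rewrite uC ue /= negbK.
have Cclosed w f : inc w f -> w \in C -> flip f w \in C.
  move=> wf wC; rewrite inE; apply/orP; right; apply/exists_inP.
  by exists f; [exact: stay wf|exact: flip_inc].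
have [w we0] := inc_some e0.
case: es tr un e0es full closed @C noexit stay Cclosed => [|f es] tr un e0es _ _ C _ stay Cclosed.
  by exists w, [:: e0]; rewrite /= we0.
move: tr => /= /andP[vf _].
have vC : v \in C by rewrite inE eqxx.
have wC := connected_graph Cclosed vf we0 vC.
by case/negP: e0es; apply: stay we0.
Qed.

Lemma euler_trail (v0 : V) :
  exists v es, [/\ trail v es, uniq es & forall e, e \in es].
Proof.
have [n] := ubnP #|E|; suff : forall n v es, trail v es -> uniq es -> (#|E| < n + size es)%N ->
    exists v es, [/\ trail v es, uniq es & forall e, e \in es].
  by move=> h En; apply: (h n v0 [::]) => //; rewrite addn0.
elim=> [|{}n IH] v es tr un sz.
  by have := uniq_leq_size un (fun e _ => mem_enum E e); rewrite -cardE leqNgt sz.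
have [all_in|[v' [es' [tr' un' lt_es]]]] := trail_extend tr un; first by exists v, es.
by apply: IH tr' un' _; lia.
Qed.

End EulerTrail.

(** * Abstract arrangements and the order of their ends *)

(** Walking along a curve, [B] lists the curves that it crosses, [m b] tells
    whether the initial sign with respect to [b] is the wanted one, and
    [o c b] tells that [c] is crossed before [b].  The crossing with [b]
    counts when all other signs are as wanted there, that is, when the set of
    parameters with all signs as wanted begins or ends there; this set is an
    interval. *)
Lemma line_parity (J : eqType) (o : rel J) (m : pred J) (B : seq J) :
  uniq B -> pairwise (fun b c => o b c && ~~ o c b) B ->
  odd (count (fun b => all (fun c => (c == b) || (m c (+) o c b)) B) B) =
    all m B (+) all (predC m) B.
Proof.
elim/last_ind: B => [|B z IH] //; rewrite rcons_uniq pairwise_rcons.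
move=> /andP[zB unB] /andP[/allP Bz oB].
rewrite !all_rcons -cats1 count_cat /= addn0 oddD.  rewrite !all_cat /= eqxx /= andbT. 
have -> : all (fun c => (c == z) || (m c (+) o c z)) B = all (predC m) B.
  apply: eq_in_all => c cB /=; have /andP[-> _] := Bz c cB.
  by rewrite addbT; case: eqP => // cz; rewrite cz (negbTE zB) in cB.
have -> : count (fun b => all (fun c => (c == b) || (m c (+) o c b)) (B ++ [:: z])) B =
   (m z * count (fun b => all (fun c => (c == b) || (m c (+) o c b)) B) B)%N.
  have -> : count (fun b => all (fun c => (c == b) || (m c (+) o c b)) (B ++ [:: z])) B =
     count (fun b => m z && all (fun c => (c == b) || (m c (+) o c b)) B) B.
    apply: eq_in_count => b bB; rewrite all_cat /= andbT andbC.
    have /andP[_ /negbTE->] := Bz b bB; rewrite addbF.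
    by case: eqP => // zb; rewrite zb bB in zB.
  by case: (m z); rewrite ?mul1n ?mul0n // count_pred0.
rewrite oddM (IH unB oB) oddb.
by case: (m z); case: (all m B); case: (all (predC m) B).
Qed.

Lemma sum_sym_even (I : finType) (f : I -> I -> nat) :
  (forall a, f a a = 0%N) -> (forall a b, f a b = f b a) ->
  ~~ odd (\sum_a \sum_b f a b).
Proof.
move=> f0 fS; rewrite pair_bigA /=.
rewrite (bigID (fun p : I * I => enum_rank p.1 < enum_rank p.2)%N) /=.
rewrite [X in (_ + X)%N](bigID (fun p : I * I => enum_rank p.1 == enum_rank p.2)) /=.
rewrite [X in (_ + (X + _))%N]big1 ?add0n; last first.
  by move=> [a b] /andP[_ /eqP/enum_rank_inj /= ->].
rewrite [X in (_ + X)%N](reindex_inj (h := fun p : I * I => (p.2, p.1))) /=; last first.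
  by move=> [a b] [c d] [-> ->].
rewrite [X in (_ + X)%N](eq_big (fun p : I * I => enum_rank p.1 < enum_rank p.2)%N
  (fun p => f p.1 p.2)) ?addnn ?odd_double //.
  by move=> [a b] /=; rewrite -leqNgt ltn_neqAle andbC eq_sym.
Qed.

Section AbstractArrangement.
Variables (I : finType) (R : realDomainType).
(* Curve [a] crosses curve [b] if [x a b], at the parameter [t a b]; the sign
   with respect to [b] is [s a b] at the beginning of [a]. *)
Variables (x : rel I) (t : I -> I -> R) (s : I -> I -> bool).
Local Open Scope ring_scope.
Implicit Types (a b c : I) (u : R) (v : {ffun I -> bool}) (e : I * bool).

Definition sign_on a u b := s a b (+) (x a b && (t a b < u)).
(** The ends of [a] are [(a, false)], the beginning, and [(a, true)]. *)
Definition end_sign e b := s e.1 b (+) (x e.1 b && e.2).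

Hypothesis x_sym : forall a b, x a b = x b a.
Hypothesis x_irr : forall a, x a a = false.
Hypothesis t_inj : forall a b c, x a b -> x a c -> t a b = t a c -> b = c.
Hypothesis sign_crossing : forall a b c, x a b -> c != a -> c != b ->
  sign_on a (t a b) c = sign_on b (t b a) c.

Definition incident v e := [forall b, (b != e.1) ==> (v b == end_sign e b)].
Definition flip_sign e v : {ffun I -> bool} := [ffun b => v b (+) (b == e.1)].

Definition at_crossing v a b := x a b &&
  [forall c, (c != a) && (c != b) ==> (v c == sign_on a (t a b) c)].

Lemma at_crossing_sym v a b : at_crossing v a b = at_crossing v b a.
Proof.
rewrite /at_crossing x_sym; case xba: (x b a) => //=.
by apply: eq_forallb => c; rewrite andbC; case: (boolP (_ && _)) => //= /andP[ca cb];
   rewrite sign_crossing // x_sym.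
Qed.

Lemma incident_parity v a :
  odd (incident v (a, false) + incident v (a, true)) =
  odd (\sum_b at_crossing v a b).
Proof.
pose ncm := [forall c, (c != a) && ~~ x a c ==> (v c == s a c)].
pose B := sort (relpre (t a) <=%R) (enum (x a)).
pose m c := v c == s a c.
have memB b : (b \in B) = x a b by rewrite mem_sort mem_enum.
have uniqB : uniq B by rewrite sort_uniq enum_uniq.
have incE d : incident v (a, d) = ncm && all (fun c => m c (+) d) B.
  apply/forallP/andP => /= [h|[/forallP h1 /allP h2] b]; first split.
  - apply/forallP => c; apply/implyP => /andP[ca xac]; have := h c.
    by rewrite ca /end_sign /= (negbTE xac) addbF.
  - apply/allP => c; rewrite memB => xac; have ca : c != a.
      by apply: contraTneq xac => ->; rewrite x_irr.
    by have := h c; rewrite ca /end_sign /= xac /m; case: (v c); case: (s a c); case: d {h}.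
  - apply/implyP => ba; rewrite /end_sign /=; case xab: (x a b).
      have := h2 b; rewrite memB xab => /(_ isT); rewrite /m.
      by case: (v b); case: (s a b); case: d {h2}.
    by have := h1 b; rewrite ba xab /= addbF.
have crossE b : at_crossing v a b =
    [&& b \in B, ncm & all (fun c => (c == b) || (m c (+) (t a c < t a b))) B].
  rewrite /at_crossing memB; case xab: (x a b) => //=.
  apply/forallP/andP => [h|[/forallP h1 /allP h2] c]; first split.
  - apply/forallP => c; apply/implyP => /andP[ca xac]; have := h c.
    rewrite ca /sign_on (negbTE xac) addbF /=.
    by case: eqP => // cb; rewrite cb xab in xac.
  - apply/allP => c; rewrite memB => xac; have ca : c != a.
      by apply: contraTneq xac => ->; rewrite x_irr.
    have := h c; rewrite ca /sign_on xac /m /=; case: (c == b) => //=.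
    by case: (v c); case: (s a c); case: (_ < _).
  - apply/implyP => /andP[ca cb]; rewrite /sign_on; case xac: (x a c).
      have := h2 c; rewrite memB xac (negbTE cb) /m /= => /(_ isT).
      by case: (v c); case: (s a c); case: (_ < _).
    by have := h1 c; rewrite ca xac /= addbF.
rewrite !incE (eq_bigr _ (fun b _ => congr1 nat_of_bool (crossE b))).
have -> : (\sum_b [&& b \in B, ncm & all (fun c => (c == b) || (m c (+) (t a c < t a b)%R)) B])%N
  = (ncm * count (fun b => all (fun c => (c == b) || (m c (+) (t a c < t a b)%R)) B) B)%N.
  pose g b := all (fun c => (c == b) || (m c (+) (t a c < t a b)%R)) B.
  transitivity (\sum_(b <- B) ncm * g b)%N.
    rewrite [RHS]big_uniq // [RHS]big_mkcond /=; apply: eq_bigr => b _.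
    by rewrite -/(g b); case: (b \in B); case: (ncm); case: (g b).
  rewrite -sum1_count big_distrr /= [RHS]big_mkcond /=.
  by apply: eq_bigr => b _; rewrite -/(g b); case: (g b); rewrite ?muln1 ?muln0.
rewrite oddM oddD !oddb.
rewrite (@line_parity _ (fun b c => t a b < t a c) m) //.
  rewrite (eq_all (a1 := fun c => m c (+) false) (a2 := m)); last by move=> c; rewrite addbF.
  rewrite (eq_all (a1 := fun c => m c (+) true) (a2 := predC m)); last by move=> c; rewrite addbT.
  by case: (ncm).
have : pairwise (relpre (t a) <=%R) B.
  rewrite -sorted_pairwise; last by move=> p q r /=; apply: le_trans.
  by apply: sort_sorted => p q; apply: le_total.
move=> leB; have : pairwise [rel b c | (t a b <= t a c) && (b != c)] B.
  by rewrite pairwise_relI leB -uniq_pairwise.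
apply: (sub_in_pairwise (P := x a)); last by apply/allP => b; rewrite memB.
move=> b c; rewrite !unfold_in => xab xac /andP[bc nbc].
have : t a b < t a c by rewrite lt_neqAle bc andbT; apply: contra_neq nbc => /t_inj; apply.
by move=> lt_bc; rewrite /= lt_bc -leNgt ltW.
Qed.

(** Summing [incident_parity] over all curves, every crossing is counted from
    both of its curves. *)
Lemma even_incident v : ~~ odd #|[pred e | incident v e]|.
Proof.
have -> : #|[pred e | incident v e]| =
   (\sum_a (incident v (a, false) + incident v (a, true)))%N.
  rewrite -sum1_card big_mkcond /=.
  rewrite -(pair_bigA _ (fun a d => if incident v (a, d) then 1 else 0))%N /=.
  by apply: eq_bigr => a _; rewrite big_bool addnC; do 2 case: incident.
suff -> : odd (\sum_a (incident v (a, false) + incident v (a, true))) =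
    odd (\sum_a \sum_b at_crossing v a b).
  apply: sum_sym_even => [a|a b]; last by rewrite at_crossing_sym.
  by rewrite /at_crossing x_irr.
elim/big_rec2: _ => // a y1 y2 _ IH.
by rewrite oddD incident_parity IH -oddD.
Qed.

Hypothesis ends_connected : forall C : {set {ffun I -> bool}},
  (forall v e, incident v e -> v \in C -> flip_sign e v \in C) ->
  forall v e w f, incident v e -> incident w f -> v \in C -> w \in C.

Lemma incident_some e : exists v, incident v e.
Proof.
exists [ffun b => end_sign e b]; apply/forallP => b; apply/implyP => _.
by rewrite ffunE.
Qed.

Lemma flip_sign_incident v e : incident v e -> incident (flip_sign e v) e.
Proof.
move=> /forallP ve; apply/forallP => b; apply/implyP => be.
by have := ve b; rewrite be ffunE (negbTE be) addbF.
Qed.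

Lemma flip_sign_neq v e : flip_sign e v != v.
Proof.
apply/eqP => /ffunP/(_ e.1); rewrite ffunE eqxx addbT => h.
by case: (v e.1) h.
Qed.

Lemma incident_two v w e :
  incident v e -> incident w e -> w = v \/ w = flip_sign e v.
Proof.
move=> /forallP ve /forallP we.
have vw b : b != e.1 -> w b = v b.
  by move=> be; have := ve b; have := we b; rewrite be => /eqP-> /eqP->.
have [vwe|vwe] := eqVneq (w e.1) (v e.1); [left|right]; apply/ffunP => b.
  by have [->//|/vw] := eqVneq b e.1.
rewrite ffunE; have [->|/vw->] := eqVneq b e.1; last by rewrite addbF.
by rewrite addbT; case: (w e.1) vwe; case: (v e.1).
Qed.

Lemma trail_sign v es b :
  trail_end flip_sign v es b = v b (+) odd (count (fun e => e.1 == b) es).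
Proof.
elim: es v => [|e es IH] v /=; first by rewrite addbF.
by rewrite IH ffunE oddD -addbA oddb eq_sym.
Qed.

(** Along an Eulerian trail that starts at the sign vector [N], the sign with
    respect to [b] changes exactly when an end of [b] is used. *)
Lemma end_positions : exists (N : I -> bool) (pos : I * bool -> nat),
  injective pos /\ forall e b, b != e.1 ->
    end_sign e b = N b (+) (pos (b, false) < pos e)%N (+) (pos (b, true) < pos e)%N.
Proof.
have [v [es [tr un all_in]]] := euler_trail flip_sign_incident
  (fun v e => flip_sign_neq v e) incident_two incident_some even_incident
  ends_connected [ffun=> false].
exists v, (index^~ es); split=> [e f|e b be].
  by move=> /(congr1 (nth e es)); rewrite !nth_index.
set i := index e es.
have := tr; rewrite -{1}(cat_take_drop i es) trail_cat (drop_nth e) ?index_mem //=.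
rewrite nth_index // => /and3P[_ /forallP/(_ b) + _]; rewrite be => /eqP <-.
rewrite trail_sign -addbA; congr (_ (+) _).
have -> : count (fun f => f.1 == b) (take i es) =
    (((b, false) \in take i es) + ((b, true) \in take i es))%N.
  rewrite -!(count_uniq_mem _ (take_uniq _ un)) -count_predUI.
  rewrite [X in (_ + X)%N](eq_count (a2 := pred0)) ?count_pred0 ?addn0.
    by apply: eq_count => -[c []] /=; rewrite !xpair_eqE /= ?andbT ?andbF ?orbF.
  by move=> [c []] /=; rewrite !xpair_eqE /= ?andbF.
by rewrite oddD !oddb !in_take.
Qed.

End AbstractArrangement.

(** * The order of the first ends *)

Section OrderedEnds.
Variables (I : finType) (R : realDomainType).
(* Curve [a] is directed from its first end, at position [p1 a], to its last
   end, at position [p2 a].  The side of [b] that is met between [p1 b] and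
   [p2 b] is called below, and [D a b] says that [a] begins below [b]. *)
Variables (p1 p2 : I -> nat) (x : rel I) (D : I -> I -> bool) (t : I -> I -> R).
Local Open Scope ring_scope.
Implicit Types (a b c : I) (u : R).
Hypothesis p1_lt_p2 : forall a, (p1 a < p2 a)%N.
Hypothesis p12 : forall a b, p1 a != p2 b.
Hypothesis p22 : forall a b, a != b -> p2 a != p2 b.
Hypothesis first_end : forall a b, a != b -> D a b = (p1 b < p1 a)%N (+) (p2 b < p1 a)%N.
Hypothesis last_end : forall a b, a != b ->
  D a b (+) x a b = (p1 b < p2 a)%N (+) (p2 b < p2 a)%N.
Hypothesis x_sym : forall a b, x a b = x b a.
Hypothesis t_inj : forall a b c, x a b -> x a c -> t a b = t a c -> b = c.

Definition below_on a u b := D a b (+) (x a b && (t a b < u)).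

Hypothesis below_crossing : forall a b c, x a b -> c != a -> c != b ->
  below_on a (t a b) c = below_on b (t b a) c.

(** What is known about the sign vector of a point: for every subfamily [J],
    the restriction to [J] is found next to one of its curves. *)
Definition realized (w : I -> bool) := forall J : {set I}, J != set0 ->
  exists a u, a \in J /\ forall b, b \in J -> b != a ->
    (x a b -> t a b != u) /\ below_on a u b = w b.

Lemma realized2 w a b : realized w -> a != b ->
  (exists u, below_on a u b = w b) \/ (exists u, below_on b u a = w a).
Proof.
move=> rw ab; have [|c [u [+ h]]] := rw [set a; b].
  by apply/set0Pn; exists a; rewrite !inE eqxx.
rewrite !inE => /orP[]/eqP cE; subst c; [left|right]; exists u.
  by have [] := h b; rewrite ?inE ?eqxx ?orbT // eq_sym.
by have [] := h a; rewrite ?inE ?eqxx.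
Qed.

(** Two disjoint curves follow each other, and then no point is below both, or
    they are nested, and then no point is below the inner one only. *)
Lemma not_crossing w a b : (p1 a < p1 b)%N -> realized w -> ~~ x a b ->
  [/\ (p2 a < p1 b)%N & ~~ (w a && w b)] \/
  [/\ (p2 b < p2 a)%N & w a || ~~ w b].
Proof.
move=> pab rw xab; have ab : a != b by apply: contraTneq pab => ->; rewrite ltnn.
have ba : b != a by rewrite eq_sym.
have Dab := first_end ab; have Dba := first_end ba.
have Eab := last_end ab; have Eba := last_end ba.
have xba : x b a = false by rewrite x_sym (negbTE xab).
rewrite (negbTE xab) addbF in Eab; rewrite xba addbF in Eba.
have := realized2 rw ab; rewrite /below_on (negbTE xab) xba /= => R2.
have {R2} R2 : D a b = w b \/ D b a = w a.
  by case: R2 => -[_]; rewrite addbF; [left|right].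
have pa := p1_lt_p2 a; have pb := p1_lt_p2 b.
rewrite pab /= in Dba; rewrite (ltn_trans pab pb) /= in Eba.
have [h|h] := ltnP (p2 a) (p1 b).
  left; split=> //; rewrite h in Dba.
  rewrite Dab !ltnNge (ltnW pab) (ltnW (ltn_trans pab pb)) /= in R2.
  by rewrite Dba /= in R2; case: R2 => <-; rewrite ?andbF.
right; move: Dba; rewrite ltnNge h /= => Dba.
move: Eba; rewrite Dba => /esym; case: (ltngtP (p2 a) (p2 b)) (p22 ab) => // lt_ba _ _.
split=> //; rewrite Dab !ltnNge (ltnW pab) (ltnW (ltn_trans pab pb)) /= Dba in R2.
by case: R2 => <-; rewrite ?orbT.
Qed.

Lemma crossing a b : (p1 a < p1 b)%N -> x a b ->
  [/\ (p1 b < p2 a)%N, (p2 a < p2 b)%N, D a b = false & D b a = true].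
Proof.
move=> pab xab; have ab : a != b by apply: contraTneq pab => ->; rewrite ltnn.
have ba : b != a by rewrite eq_sym.
have pa := p1_lt_p2 a; have pb := p1_lt_p2 b.
have Dab : D a b = false.
  by rewrite first_end // !ltnNge (ltnW pab) (ltnW (ltn_trans pab pb)).
have := last_end ab; have := last_end ba; have := first_end ba.
rewrite Dab x_sym xab pab (ltn_trans pab pb) /=.
have := p22 ab; have := p12 b a; case: (ltngtP (p2 a) (p1 b)) => //.
  by move=> lt_ab _ _ -> /=; rewrite (ltn_trans lt_ab pb).
by case: (ltngtP (p2 a) (p2 b)) => // _ _ _ _ ->.
Qed.

(** When the three curves do not cross pairwise, one of the patterns is
    excluded by a disjoint pair.  When they do, they form a triangle, and a
    pattern can only be found next to a curve if that curve meets the other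
    two in a definite order; one pattern needs [a] before [b] on [c], the
    other needs [b] before [a]. *)
Lemma no_zigzag w w' c a b : realized w -> realized w' ->
  (p1 c < p1 a)%N -> (p1 a < p1 b)%N ->
  [/\ ~~ w c, w a & ~~ w b] -> [/\ w' c, ~~ w' a & w' b] -> False.
Proof.
move=> rw rw' pca pab [wc wa wb] [wc' wa' wb'].
have pcb := ltn_trans pca pab.
have neq d e : (p1 d < p1 e)%N -> (d != e) * (e != d).
  by move=> de; split; apply: contraTneq de => ->; rewrite ltnn.
have [nca nac] := neq _ _ pca; have [nab nba] := neq _ _ pab; have [ncb nbc] := neq _ _ pcb.
have pa := p1_lt_p2 a; have pb := p1_lt_p2 b.
have side_ca : x c a \/ (p2 c < p1 a)%N.
  have [|nx] := boolP (x c a); [by left|right].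
  by case: (not_crossing pca rw nx) => -[] //; rewrite (negbTE wc) wa.
have side_ab : x a b \/ (p2 a < p1 b)%N.
  have [|nx] := boolP (x a b); [by left|right].
  by case: (not_crossing pab rw' nx) => -[] //; rewrite (negbTE wa') wb'.
have nest_cb : x c b \/ (p2 b < p2 c)%N.
  have [|nx] := boolP (x c b); [by left|right].
  by case: (not_crossing pcb rw' nx) => -[] //; rewrite wc' wb'.
have xca : x c a.
  case: side_ca => // h; case: nest_cb => [/(crossing pcb)[h1 _ _ _]|h1];
    by move: h h1 pab pb; clear; lia.
have [h1 h2 Dca Dac] := crossing pca xca.
have xab : x a b.
  case: side_ab => // h; case: nest_cb => [/(crossing pcb)[h3 _ _ _]|h3];
    by move: h h3 h2 pb; clear; lia.
have [h3 h4 Dab Dba] := crossing pab xab.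
have xcb : x c b by case: nest_cb => // h; move: h h2 h4; clear; lia.
have [_ _ Dcb Dbc] := crossing pcb xcb.
have [xac xba] : x a c /\ x b a by rewrite ![x _ c]x_sym ![x b _]x_sym.
have xbc : x b c by rewrite x_sym.
have := below_crossing xca nbc nba; have := below_crossing xcb nac nab.
rewrite /below_on Dca Dcb Dab Dba xca xcb xab xba /= => cb_a ca_b.
have tneq d e f : x d e -> x d f -> e != f -> t d e != t d f.
  by move=> de df; apply: contra_neq; apply: t_inj.
(* The pattern of [w] forces [a] before [b] on [c]: the orders of the crossings
   on [a] and on [b] are tied to this one by [ca_b] and [cb_a]. *)
have {rw} up : t c a < t c b.
  have [|d [u [+ h]]] := rw [set c; a; b].
    by apply/set0Pn; exists c; rewrite !inE eqxx.
  rewrite !inE -orbA => /or3P[]/eqP dE; subst d.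
  - have [] := h a; rewrite ?inE ?eqxx ?orbT // => /(_ xca) _.
    rewrite /below_on Dca xca wa /= => ua.
    have [] := h b; rewrite ?inE ?eqxx ?orbT // => _.
    rewrite /below_on Dcb xcb (negbTE wb) /= => /negbT; rewrite -leNgt; exact: lt_le_trans.
  - have [] := h c; rewrite ?inE ?eqxx ?orbT // => _.
    rewrite /below_on Dac xac (negbTE wc) /= => /negbFE uc.
    have [] := h b; rewrite ?inE ?eqxx ?orbT // => _.
    rewrite /below_on Dab xab (negbTE wb) /= => /negbT; rewrite -leNgt => ub.
    have tac : t a c < t a b by apply: lt_le_trans ub.
    move: ca_b; rewrite [t a b < _]ltNge (ltW tac) /= => /negbT; rewrite -leNgt le_eqVlt.
    by rewrite (negbTE (tneq _ _ _ xca xcb nab)).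
  - have [] := h c; rewrite ?inE ?eqxx ?orbT // => _.
    rewrite /below_on Dbc xbc (negbTE wc) /= => /negbFE uc.
    have [] := h a; rewrite ?inE ?eqxx ?orbT // => _.
    rewrite /below_on Dba xba wa /=; rewrite -leNgt => ub.
    have tbc : t b c < t b a by apply: lt_le_trans ub.
    by rewrite cb_a [t b a < _]ltNge (ltW tbc).
have [|d [u [+ h]]] := rw' [set c; a; b].
  by apply/set0Pn; exists c; rewrite !inE eqxx.
rewrite !inE -orbA => /or3P[]/eqP dE; subst d.
- have [] := h a; rewrite ?inE ?eqxx ?orbT // => _.
  rewrite /below_on Dca xca (negbTE wa') /= => /negbT; rewrite -leNgt => ua.
  have [] := h b; rewrite ?inE ?eqxx ?orbT // => _.
  rewrite /below_on Dcb xcb wb' /= => ub.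
  by have := lt_trans (lt_le_trans ub ua) up; rewrite ltxx.
- have [] := h c; rewrite ?inE ?eqxx ?orbT // => _.
  rewrite /below_on Dac xac wc' /=; rewrite -leNgt => uc.
  have [] := h b; rewrite ?inE ?eqxx ?orbT // => _.
  rewrite /below_on Dab xab wb' /= => ub.
  by move: ca_b; rewrite (lt_le_trans ub uc) ltNge (ltW up).
- have [] := h c; rewrite ?inE ?eqxx ?orbT // => _.
  rewrite /below_on Dbc xbc wc' /=; rewrite -leNgt => uc.
  have [] := h a; rewrite ?inE ?eqxx ?orbT // => _.
  rewrite /below_on Dba xba (negbTE wa') /= => /negbFE ub.
  by move: cb_a; rewrite up (lt_le_trans ub uc).
Qed.

End OrderedEnds.

Section ZigzagFreeOrder.
Variables (I : finType) (R : realDomainType).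
Variables (x : rel I) (t : I -> I -> R) (s : I -> I -> bool).
Local Open Scope ring_scope.
Hypothesis x_sym : forall a b, x a b = x b a.
Hypothesis x_irr : forall a, x a a = false.
Hypothesis t_inj : forall a b c, x a b -> x a c -> t a b = t a c -> b = c.
Hypothesis sign_crossing : forall a b c, x a b -> c != a -> c != b ->
  sign_on x t s a (t a b) c = sign_on x t s b (t b a) c.
Hypothesis ends_connected : forall C : {set {ffun I -> bool}},
  (forall v e, incident x s v e -> v \in C -> flip_sign e v \in C) ->
  forall v e w f, incident x s v e -> incident x s w f -> v \in C -> w \in C.

(** The analogue of [realized] before the curves are directed. *)
Definition touched (w : I -> bool) := forall J : {set I}, J != set0 ->
  exists a u, a \in J /\ forall b, b \in J -> b != a ->
    (x a b -> t a b != u) /\ sign_on x t s a u b = w b.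

Lemma zigzag_free_order : exists (N : I -> bool) (rank : I -> nat),
  injective rank /\ forall w w' c a b, touched w -> touched w' ->
    (rank c < rank a)%N -> (rank a < rank b)%N ->
    [/\ w c = N c, w a = ~~ N a & w b = N b] ->
    [/\ w' c = ~~ N c, w' a = N a & w' b = ~~ N b] -> False.
Proof.
have [N [pos [pos_inj posE]]] := end_positions x_sym x_irr t_inj sign_crossing ends_connected.
(* The first end of [a] is the beginning of [a], unless [phi a]. *)
pose phi a := (pos (a, true) < pos (a, false))%N.
pose p1 a := pos (a, phi a); pose p2 a := pos (a, ~~ phi a).
pose D a b := end_sign x s (a, phi a) b (+) N b.
pose sg a (u : R) := if phi a then - u else u.
exists N, p1; split=> [a b /pos_inj[]//|w w' c a b tw tw' ca ab wN w'N].
have posN a' b' d d' : (a', d) != (b', d') -> pos (a', d) != pos (b', d').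
  by apply: contra_neq => /pos_inj.
have endE a' b' d : a' != b' -> end_sign x s (a', d) b' (+) N b' =
    (p1 b' < pos (a', d))%N (+) (p2 b' < pos (a', d))%N.
  rewrite eq_sym => ab'; rewrite posE // /p1 /p2.
  by case: (phi b'); case: (N b'); do 2 case: (_ < _)%N.
have belowE a' b' u : (x a' b' -> t a' b' != u) ->
    below_on x D (fun a b => sg a (t a b)) a' (sg a' u) b' = sign_on x t s a' u b' (+) N b'.
  rewrite /below_on /D /sign_on /end_sign /= /sg; case: (x a' b') => [/(_ isT) tu|_] /=.
    case: (phi a'); rewrite ?ltrN2; last by rewrite addbF addbAC.
    rewrite [u < _]ltNge le_eqVlt (negbTE tu) /=.
    by case: (s a' b'); case: (N b'); case: (_ < _).
  by rewrite !addbF.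
have real w0 : touched w0 ->
    realized x D (fun a b => sg a (t a b)) (fun b => w0 b (+) N b).
  move=> tw0 J J0; have [a' [u [a'J h]]] := tw0 J J0.
  exists a', (sg a' u); split=> // b' b'J ba'; have [h1 h2] := h b' b'J ba'.
  split; last by rewrite belowE // h2.
  by move=> /h1; apply: contra_neq; rewrite /sg; case: ifP => // _ /oppr_inj.
apply: (no_zigzag (p1 := p1) (p2 := p2) (x := x) (D := D)
  (t := fun a b => sg a (t a b)) _ _ _ _ _ x_sym _ _ (real w tw) (real w' tw') ca ab).
- move=> a'; rewrite /p1 /p2 /phi; have := posN a' a' true false.
  by rewrite xpair_eqE eqxx => /(_ isT); case: (ltngtP (pos (a', true))) => /=.
- move=> a' b'; apply: posN; rewrite xpair_eqE; case: eqP => //= ->.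
  by case: (phi b').
- by move=> a' b' ab'; apply: posN; rewrite xpair_eqE negb_and ab'.
- by move=> a' b' ab'; rewrite /D endE.
- move=> a' b' ab'; rewrite /p2 -(endE a' b' (~~ phi a')) // /D /end_sign /=.
  by case: (phi a'); case: (x a' b'); case: (s a' b'); case: (N b').
- move=> a' b' c' ab' ac'; rewrite /sg => e; apply: (t_inj ab' ac').
  by move: e; case: (phi a') => // /oppr_inj.
- move=> a' b' c' ab' ca' cb'.
  have ta : x a' c' -> t a' c' != t a' b'.
    by move=> xac; apply: contra_neq cb' => /(t_inj xac ab').
  have tb : x b' c' -> t b' c' != t b' a'.
    by rewrite (x_sym a') in ab'; move=> xbc; apply: contra_neq ca' => /(t_inj xbc ab').
  have := belowE _ _ _ ta; have := belowE _ _ _ tb.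
  by rewrite (sign_crossing ab' ca' cb') => eb ea; exact: etrans ea (esym eb).
- by case: wN => -> -> ->; case: (N c); case: (N a); case: (N b).
- by case: w'N => -> -> ->; case: (N c); case: (N a); case: (N b).
Qed.

End ZigzagFreeOrder.

(** * Lexicographic order of the points *)

Lemma lexi_first_difference (I : eqType) (rank : I -> nat) (ls : seq I)
    (f g : I -> bool) (k1 k2 : nat) :
  pairwise (fun a b => rank a < rank b)%N ls ->
  ((rcons (map (fun a => nat_of_bool (f a)) ls) k1 : seqlexi nat) <
   rcons (map (fun a => nat_of_bool (g a)) ls) k2)%O ->
  {in ls, f =1 g} \/
  exists c, [/\ f c = false, g c = true &
    forall a, a \in ls -> f a != g a -> a != c -> (rank c < rank a)%N].
Proof.
elim: ls => [|b ls IH]; first by left.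
rewrite [map _ _]/= [X in (_ < X)%O]/= !rcons_cons /= => /andP[/allP bl pw].
rewrite ltxi_cons leEnat => /andP[le_fg lt_fg].
have [fgb|fgb] := eqVneq (f b) (g b).
  move: lt_fg; rewrite fgb leqnn /= => /(IH pw)[eq_fg|[c [fc gc h]]].
    by left=> a; rewrite inE => /predU1P[->|/eq_fg].
  right; exists c; split=> // a; rewrite inE => /predU1P[->|/h//].
  by rewrite fgb eqxx.
right; exists b; move: le_fg fgb; case: (f b); case: (g b) => // _ _; split=> // a.
by rewrite inE => /predU1P[->|/bl//]; rewrite eqxx.
Qed.

Section LexicographicOrder.
Variables (I T : finType) (sg : T -> I -> bool) (N : I -> bool) (rank : I -> nat).
Hypothesis rank_inj : injective rank.
Hypothesis no_zigzag_points : forall p q c a b,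
  (rank c < rank a)%N -> (rank a < rank b)%N ->
  [/\ sg p c = N c, sg p a = ~~ N a & sg p b = N b] ->
  [/\ sg q c = ~~ N c, sg q a = N a & sg q b = ~~ N b] -> False.

(** Suppose that two consecutive points of an alternation between curves
    [a < b] are sorted against their signs at [a].  Then they differ earlier,
    at some [c < a], in the opposite direction, and on [c < a < b] they show
    the two forbidden patterns. *)
Lemma lexicographic_ABA_free : exists (lt : rel T) (F : {set {set T}}),
  [/\ strict_total lt, noABA lt F &
      forall i, [set p | sg p i] \in F :|: complements F].
Proof.
pose m p a := sg p a (+) N a.
pose ls := sort (relpre rank leq) (enum I).
have lsP a : a \in ls by rewrite mem_sort mem_enum.
have pw : pairwise (fun a b => rank a < rank b)%N ls.
  have le_ls : pairwise (relpre rank leq) ls.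
    rewrite -sorted_pairwise; last by move=> ? ? ? /=; apply: leq_trans.
    by apply: sort_sorted => ? ?; apply: leq_total.
  have : pairwise [rel a b | (rank a <= rank b)%N && (a != b)] ls.
    by rewrite pairwise_relI le_ls -uniq_pairwise sort_uniq enum_uniq.
  apply: sub_pairwise => a b /= /andP[le_ab ab].
  by rewrite ltn_neqAle le_ab andbT; apply: contra_neq ab => /rank_inj.
(* The rank of [p] at the end breaks ties between equal sign vectors. *)
pose key p : seqlexi nat :=
  rcons (map (fun a => nat_of_bool (m p a)) ls) (enum_rank p).
have key_inj : injective key by move=> p q /rcons_inj[_ /ord_inj/enum_rank_inj].
pose lt p q := (key p < key q)%O.
have first_diff p q a : lt p q -> m p a = true -> m q a = false ->
    exists c, [/\ m p c = false, m q c = true & (rank c < rank a)%N].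
  move=> /(lexi_first_difference pw)[eq_pq pa qa|[c [pc qc h]] pa qa].
    by have := eq_pq a (lsP a); rewrite pa qa.
  exists c; split=> //; apply: h (lsP a) _ _; first by rewrite pa qa.
  by apply/eqP => ac; rewrite ac pc in pa.
have zz p q c a b : (rank c < rank a)%N -> (rank a < rank b)%N ->
    m p c = false -> m p a = true -> m p b = false ->
    m q c = true -> m q a = false -> m q b = true -> False.
  have mN r d : m r d = true -> sg r d = ~~ N d by rewrite /m; case: (sg r d); case: (N d).
  have mF r d : m r d = false -> sg r d = N d by rewrite /m; case: (sg r d); case: (N d).
  move=> ca ab /mF p_c /mN pa /mF pb /mN qc /mF qa /mN qb.
  exact: (no_zigzag_points ca ab (And3 p_c pa pb) (And3 qc qa qb)).
exists lt, [set [set p | ~~ m p i] | i : I]; split.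
- split=> [p|q p r|p q pq]; [exact: ltxx|exact: lt_trans|].
  by apply: lt_total; apply: contra_neq pq => /key_inj.
- move=> _ _ y1 y2 y3 /imsetP[a _ ->] /imsetP[b _ ->] lt12 lt23; rewrite !inE !negbK.
  move=> /negbTE a1 b1 /negbTE a3 b3 /negbTE b2; apply/negP => a2.
  case: (ltngtP (rank a) (rank b)) => [ab|ba|/rank_inj ab].
  + have [c [c2 c3 ca]] := first_diff _ _ _ lt23 a2 a3.
    exact: (zz _ _ _ _ _ ca ab c2 a2 b2 c3 a3 b3).
  + have [c [c1 c2 cb]] := first_diff _ _ _ lt12 b1 b2.
    exact: (zz _ _ _ _ _ cb ba c1 b1 a1 c2 b2 a2).
  + by rewrite ab b2 in a2.
- move=> i; rewrite inE complementsE; case Ni: (N i); apply/orP; [left|right];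
    apply/imsetP; exists i => //; apply/setP => p; rewrite !inE /m Ni.
    by rewrite addbT negbK.
  by rewrite addbF.
Qed.

End LexicographicOrder.

From mathcomp Require Import all_classical all_reals all_analysis.

Import numFieldNormedType.Exports.

Local Open Scope classical_set_scope.

(** * Connectedness in the plane *)

Section Connectedness.
Variable T : topologicalType.
Implicit Types A B : set T.

Lemma locally_constant_on_connected A B : connected A ->
  (forall p, A p -> \forall q \near p, A q -> (B q <-> B p)) ->
  forall p q, A p -> A q -> B p -> B q.
Proof.
move=> Aconn loc p q Ap Aq Bp.
pose U (b : Prop) := \bigcup_(V in [set V : set T | open V /\
  forall r, V r -> A r -> (B r <-> b)]) V.
have Uopen b : open (U b) by apply: bigcup_open => V [].
have UA r : A r -> U (B r) r.
  move=> Ar; have : nbhs r [set q | A q -> (B q <-> B r)] := loc r Ar.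
  rewrite nbhsE => -[V [Vop Vr] sub].
  by exists V => //; split=> // r' Vr' Ar'; apply: sub.
have UB b r : U b r -> A r -> (B r <-> b) by move=> [V [_ h] Vr] Ar; apply: h.
suff : A `&` B = A by move=> e; move: Aq; rewrite -{1}e => -[].
apply: Aconn; first by exists p.
- exists (U True) => //; apply/seteqP; split=> r [Ar h]; split=> //.
    by have := UA r Ar; have -> : B r = True by apply/propext; split.
  by apply/(UB _ _ h Ar).
- exists (~` U False); first exact: open_closedC.
  apply/seteqP; split=> r [Ar h]; split=> //.
    by move=> hU; have [BF _] := UB _ _ hU Ar; exact: BF h.
  apply: contrapT => nB; apply: h; have := UA r Ar.
  by have -> : B r = False by apply/propext; split.
Qed.

Lemma pairwise_connected A :
  (forall p q, A p -> A q -> exists C, [/\ C p, C q, C `<=` A & connected C]) ->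
  connected A.
Proof.
move=> h; have [->|/set0P[p Ap]] := eqVneq A set0; first exact: connected0.
have -> : A = connected_component A p.
  apply/seteqP; split; last exact: connected_component_sub.
  by move=> q Aq; have [C [Cp Cq CA Cc]] := h p q Ap Aq; exists C.
exact: component_connected.
Qed.

End Connectedness.

Section Plane.
Variable R : realType.
Local Open Scope ring_scope.
Implicit Types (A B : set R) (p q : R * R) (r : R).

Lemma rectangle_connected A B : is_interval A -> is_interval B ->
  connected (A `*` B).
Proof.
move=> /connected_intervalP Ac /connected_intervalP Bc.
apply: pairwise_connected => p q [Ap Bp] [Aq Bq].
exists ((fun x => (x, p.2)) @` A `|` (fun y => (q.1, y)) @` B); split.
- by left; exists p.1 => //; case: p {Ap Bp}.
- by right; exists q.2 => //; case: q {Aq Bq}.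
- by move=> _ [[x Ax <-]|[y By <-]].
- apply: connectedU.
  + exists (q.1, p.2); split; [by exists q.1|by exists p.2].
  + apply: connected_continuous_connected => //.
    apply: continuous_subspaceT => x.
    by apply: (@cvg_pair _ _ _ _ (nbhs x) (nbhs p.2)); [exact: cvg_id|exact: cvg_cst].
  + apply: connected_continuous_connected => //.
    apply: continuous_subspaceT => x.
    by apply: (@cvg_pair _ _ _ _ (nbhs q.1) (nbhs x)); [exact: cvg_cst|exact: cvg_id].
Qed.

Lemma plane_connected : connected [set: R * R].
Proof. by rewrite -setXTT; apply: rectangle_connected => x y _ _ z _. Qed.

Lemma ball_connected p r : connected (ball p r).
Proof.
have -> : ball p r = ball p.1 r `*` ball p.2 r by [].
by apply: rectangle_connected; rewrite ball_itv; apply: interval_is_interval.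
Qed.

(** The norm of the product is the maximum norm, so this set is a union of four
    half-planes. *)
Lemma outside_square_connected r : connected [set p : R * R | r < `|p|].
Proof.
have -> : [set p : R * R | r < `|p|] =
   ([set x | r < x] `*` setT) `|` (setT `*` [set y | r < y]) `|`
   ([set x | r < - x] `*` setT) `|` (setT `*` [set y | r < - y]).
  apply/seteqP; split=> -[x y] /=.
    rewrite prod_normE /= lt_max !ltr_normr.
    by case/orP => /orP[]; tauto.
  rewrite prod_normE /= lt_max !ltr_normr.
  by move=> [[[[h _]|[_ h]]|[h _]]|[_ h]]; rewrite h ?orbT.
have up : is_interval [set x : R | r < x].
  by move=> x y /= rx ry z /andP[xz _]; apply: lt_le_trans xz.
have down : is_interval [set x : R | r < - x].
  by move=> x y /= rx ry z /andP[_ zy]; apply: lt_le_trans ry _; rewrite lerN2.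
have all : is_interval [set: R] by [].
have big : r < `|r| + 1 by rewrite (le_lt_trans (ler_norm r)) // ltrDl.
apply: connectedU; last 2 first.
- apply: connectedU; last 2 first.
  + apply: connectedU; last 2 first.
    * exact: rectangle_connected.
    * exact: rectangle_connected.
    * by exists (`|r| + 1, `|r| + 1).
  + exact: rectangle_connected.
  + exists (- (`|r| + 1), `|r| + 1); split; first by right.
    by split=> //=; rewrite opprK.
- exact: rectangle_connected.
- exists (`|r| + 1, - (`|r| + 1)); split; first by left; left.
  by split=> //=; rewrite opprK.
Qed.

End Plane.

(** * Sides of a pseudoline *)

Section Curves.
Variable R : realType.
Local Open Scope ring_scope.
Implicit Types (f g : R -> R * R) (p q : R * R) (u : R) (H : set (R * R)).

Lemma pseudoline_far f r : pseudoline f ->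
  exists T : R, forall u, T < `|u| -> r < `|f u|.
Proof.
case=> _ _ /cvgryPgt/(_ r)/= [T1 [_ h1]] /cvgryPgt/(_ r)/= [T2 [_ h2]] _.
exists (`|T1| + `|T2|) => u; case: (lerP 0 u) => u0.
  rewrite (ger0_norm u0) => hu; apply: h1; apply: le_lt_trans hu.
  by rewrite (le_trans (ler_norm _)) // lerDl.
rewrite (ltr0_norm u0) => hu; apply: h2; rewrite -ltrN2; apply: le_lt_trans hu.
by rewrite (le_trans (ler_norm _)) // normrN lerDr.
Qed.

Lemma bounded_arc f (T : R) : continuous f -> exists r, forall u, `|u| <= T -> `|f u| <= r.
Proof.
move=> fc; have : compact (f @` `[- T, T]).
  apply: continuous_compact; last exact: segment_compact.
  exact: continuous_subspaceT.
move=> /compact_bounded [M [_ hM]]; exists (M + 1) => u uT.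
apply: (hM (M + 1)); first by rewrite ltrDl.
by exists u => //=; rewrite in_itv /= -ler_norml.
Qed.

Lemma closed_curve f : pseudoline f -> closed (range f).
Proof.
move=> fp q qcl; have fc : continuous f by case: fp.
have [T far] := pseudoline_far (`|q| + 1) fp.
have Kcl : closed (f @` `[- T, T]).
  apply: compact_closed; first exact: norm_hausdorff.
  apply: continuous_compact; last exact: segment_compact.
  exact: continuous_subspaceT.
suff : (f @` `[- T, T]) q by move=> [u _ <-]; exists u.
apply: Kcl => B Bq; have [] := qcl (B `&` ball q 1).
  by apply: filterI => //; apply: nbhsx_ballx.
move=> _ [[u _ <-] [Bu qu]]; exists (f u); split=> //; exists u => //=.
rewrite in_itv /= -ler_norml leNgt; apply/negP => /far; apply/negP.
rewrite -leNgt -lerBlDl; apply: le_trans (lerB_dist _ _) _.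
by rewrite distrC; move: qu; rewrite -ball_normE /= => /ltW.
Qed.

Lemma side_locally_constant f H p : pseudoline f -> sides f H -> ~ range f p ->
  \forall q \near p, ~ range f q /\ (H q <-> H p).
Proof.
move=> fp [x xf <-] pf.
have /(_ p pf) : open (~` range f) by apply: closed_openC; exact: closed_curve.
rewrite /interior -nbhs_ballE => -[e /= e0 pe].
apply: (filterS _ (nbhsx_ballx p e e0)) => q qe; split; first exact: pe.
have pq : connected_component (~` range f) p q.
  by exists (ball p e) => //; split=> //; [exact: ballxx|exact: ball_connected].
split=> h; apply: connected_component_trans h _ => //.
exact: connected_component_sym.
Qed.

Lemma side_on_connected f H (C : set (R * R)) : pseudoline f -> sides f H ->
  connected C -> C `<=` ~` range f -> forall p q, C p -> C q -> H p -> H q.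
Proof.
move=> fp fH Cc Cf; apply: locally_constant_on_connected => // p Cp.
near=> q => _.
have [] : ~ range f q /\ (H q <-> H p); last by [].
by near: q; apply: side_locally_constant => //; apply: Cf.
Unshelve. all: by end_near. Qed.

Lemma side_eq_or f A B H : pseudoline f -> sides f A -> sides f B -> A <> B ->
  sides f H -> H = A \/ H = B.
Proof.
case=> _ _ _ _ card2 fA fB AB fH; apply: contrapT => /not_orP[HA HB].
case/eq_cardSP: card2 => X0 _ /eq_cardSP[X1 _].
rewrite II0 card_eq0 => /eqP none.
have X01 X : sides f X -> X = X0 \/ X = X1.
  move=> fX; apply: contrapT => /not_orP[XX0 XX1].
  by have : set0 X by rewrite -none.
by case: (X01 A fA) (X01 B fB) (X01 H fH) => ? [] ? [] ?; congruence.
Qed.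

(** Since [f] has only two sides, [H] is one of the two sides between which [g]
    passes. *)
Lemma side_change f g H t : pseudoline f -> sides f H -> changes_side f g t ->
  exists b : bool, (\forall s \near t^'-, H (g s) <-> b) /\
                   (\forall s \near t^'+, H (g s) <-> ~~ b).
Proof.
move=> fp fH [A [B [fA fB AB gA gB]]].
have disj q : A q -> B q -> False.
  move: fA fB AB => [x xf <-] [y yf <-] AB Aq Bq; apply: AB.
  by rewrite (same_connected_component Aq) (same_connected_component Bq).
have [->|->] := side_eq_or fp fA fB AB fH; [exists true|exists false]; split.
- by apply: filterS gA.
- by apply: filterS gB => s Bs; split=> // As; case: (disj _ As Bs).
- by apply: filterS gA => s As; split=> // Bs; case: (disj _ As Bs).
- by apply: filterS gB.
Qed.

End Curves.

(** * From pseudoline arrangements to ABA-free hypergraphs *)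

Section Arrangement.
Local Open Scope ring_scope.
Variables (R : realType) (I : finType) (L : I -> R -> R * R) (H : I -> set (R * R)).
Hypothesis arr : pseudoline_arrangement L.
Hypothesis LH : forall i, sides (L i) (H i).
Implicit Types (i j l a b c : I) (p q : R * R) (u v : R).

Let Lp i : pseudoline (L i). Proof. by case: arr. Qed.
Let Lc i : continuous (L i). Proof. by case: (Lp i). Qed.
Let Linj i : injective (L i). Proof. by case: (Lp i). Qed.

Let no_triple a b c p : a != b -> b != c -> a != c ->
  range (L a) p -> range (L b) p -> range (L c) p -> False.
Proof.
case: arr => _ _ h ab bc ac pa pb pc.
have : (range (L a) `&` range (L b) `&` range (L c)) p by [].
by rewrite h.
Qed.

(** Points on the curve count as points outside the pseudohalfplane. *)
Definition side_of i p : bool := `[< H i p >].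

Lemma side_of_near i p : ~ range (L i) p ->
  \forall q \near p, ~ range (L i) q /\ side_of i q = side_of i p.
Proof.
move=> /(side_locally_constant (Lp i) (LH i)); apply: filterS => q [qi Hq].
by split=> //; apply: asbool_equiv_eq.
Qed.

Lemma side_of_interval i j (A : set R) : is_interval A ->
  (forall u, A u -> ~ range (L j) (L i u)) ->
  forall u v, A u -> A v -> side_of j (L i u) = side_of j (L i v).
Proof.
move=> /connected_intervalP Ac Aj u v Au Av; apply: asbool_equiv_eq.
have LAc : connected (L i @` A).
  by apply: connected_continuous_connected => //; apply: continuous_subspaceT.
have LAj : L i @` A `<=` ~` range (L j) by move=> _ [w Aw <-]; apply: Aj.
have := side_on_connected (Lp j) (LH j) LAc LAj.
by move=> h; split; apply: h; [exists u|exists v|exists v|exists u].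
Qed.

Lemma curve_trace i j : i != j -> exists (x : bool) (t : R) (s : bool),
  (forall u, range (L j) (L i u) <-> x /\ u = t) /\
  (forall u, ~ range (L j) (L i u) -> side_of j (L i u) = s (+) (x && (t < u))).
Proof.
case: arr => _ meet _ /meet[disj|[p [capE [t0 [t1 [t0p _ _ ch]]]]]].
  have out u : ~ range (L j) (L i u).
    move=> h; have : (range (L i) `&` range (L j)) (L i u) by split=> //; exists u.
    by rewrite disj.
  exists false, 0, (side_of j (L i 0)); split=> [u|u _].
    by split=> [/out//|[]].
  by rewrite addbF; apply: (side_of_interval (A := setT)).
have on u : range (L j) (L i u) <-> true /\ u = t0.
  split=> [h|[_ ->]].
    split=> //; apply: (@Linj i); rewrite t0p.
    have : (range (L i) `&` range (L j)) (L i u) by split=> //; exists u.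
    by rewrite capE.
  have : (range (L i) `&` range (L j)) p by rewrite capE.
  by rewrite t0p => -[].
have [b [bl br]] := side_change (Lp j) (LH j) ch.
exists true, t0, b; split=> // u /on/= ut; rewrite /=.
have {ut} : u != t0 by apply/eqP => e; apply: ut.
have sideb v (c : bool) : (H j (L i v) <-> c) -> side_of j (L i v) = c.
  by move=> h; apply/asboolP/idP => /h.
rewrite neq_lt => /orP[ut|ut].
  have [v [bv vt]] : exists v, (H j (L i v) <-> b) /\ v < t0.
    by apply: (@filter_ex _ t0^'-); apply: filterI => //; exact: nbhs_left_lt.
  rewrite ltNge (ltW ut) addbF -(sideb _ _ bv).
  apply: (side_of_interval (A := [set u | u < t0])) => //.
    by move=> x y /= xt yt z /andP[_ zy]; apply: le_lt_trans yt.
  by move=> w /= wt /on[_ wt0]; rewrite wt0 ltxx in wt.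
have [v [bv vt]] : exists v, (H j (L i v) <-> ~~ b) /\ t0 < v.
  by apply: (@filter_ex _ t0^'+); apply: filterI => //; exact: nbhs_right_gt.
rewrite ut addbT -(sideb _ _ bv).
apply: (side_of_interval (A := [set u | t0 < u])) => //.
  by move=> x y /= xt yt z /andP[xz _]; apply: lt_le_trans xz.
by move=> w /= wt /on[_ wt0]; rewrite wt0 ltxx in wt.
Qed.

Lemma curve_traces : exists (x : rel I) (t : I -> I -> R) (s : I -> I -> bool),
  (forall i, x i i = false) /\ forall i j, i != j ->
  (forall u, range (L j) (L i u) <-> x i j /\ u = t i j) /\
  (forall u, ~ range (L j) (L i u) -> side_of j (L i u) = sign_on x t s i u j).
Proof.
have : forall k : I * I, exists y : bool * R * bool, if k.1 == k.2 then y.1.1 = false else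
    (forall u, range (L k.2) (L k.1 u) <-> y.1.1 /\ u = y.1.2) /\
    (forall u, ~ range (L k.2) (L k.1 u) ->
      side_of k.2 (L k.1 u) = y.2 (+) (y.1.1 && (y.1.2 < u))).
  move=> [i j] /=; case: (eqVneq i j) => [_|ij]; first by exists (false, 0, false).
  by have [x [t [s h]]] := curve_trace ij; exists (x, t, s).
move=> /choice[y yP]; exists (fun i j => (y (i, j)).1.1), (fun i j => (y (i, j)).1.2),
  (fun i j => (y (i, j)).2); split=> [i|i j ij].
  by have := yP (i, i); rewrite /= eqxx.
by have := yP (i, j); rewrite /= (negbTE ij).
Qed.

Variables (x : rel I) (t : I -> I -> R) (s : I -> I -> bool).
Hypothesis x_irr : forall i, x i i = false.
Hypothesis on_curve : forall i j, i != j ->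
  forall u, range (L j) (L i u) <-> x i j /\ u = t i j.
Hypothesis off_curve : forall i j, i != j ->
  forall u, ~ range (L j) (L i u) -> side_of j (L i u) = sign_on x t s i u j.

Let x_neq i j : x i j -> i != j.
Proof. by apply: contraTneq => ->; rewrite x_irr. Qed.

Lemma crossing_point i j : x i j -> x j i /\ L i (t i j) = L j (t j i).
Proof.
move=> xij; have ij := x_neq xij; have ji : j != i by rewrite eq_sym.
have [_ /(_ (conj xij erefl))[v _ vE]] := on_curve ij (t i j).
have [] := on_curve ji v; rewrite vE => /(_ _)[|xji vt _]; first by exists (t i j).
by split=> //; rewrite -vE vt.
Qed.

Lemma crossing_sym i j : x i j = x j i.
Proof. by apply/idP/idP => /crossing_point[]. Qed.

Lemma range_crossing i j : x i j -> range (L j) (L i (t i j)).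
Proof. by move=> xij; apply/on_curve; rewrite ?x_neq. Qed.

Lemma crossing_inj a b c : x a b -> x a c -> t a b = t a c -> b = c.
Proof.
move=> xab xac e; apply/eqP/negPn/negP => bc.
apply: (no_triple (x_neq xab) bc (x_neq xac) (p := L a (t a b))).
- by exists (t a b).
- exact: range_crossing.
- by rewrite e; apply: range_crossing.
Qed.

Lemma sign_crossing a b c : x a b -> c != a -> c != b ->
  sign_on x t s a (t a b) c = sign_on x t s b (t b a) c.
Proof.
move=> xab ca cb; have [xba e] := crossing_point xab.
have pc : ~ range (L c) (L a (t a b)).
  move=> h; apply: (no_triple (x_neq xab) _ _ _ (range_crossing xab) h).
  - by rewrite eq_sym.
  - by rewrite eq_sym.
  - by exists (t a b).
rewrite -!off_curve 1?eq_sym //; first by rewrite e.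
by rewrite -e.
Qed.

(** If the cell of [p] in the subarrangement [J] had no boundary point, it would
    be open and closed, hence the whole plane. *)
Lemma cell_boundary (J : {set I}) a0 p : a0 \in J -> exists q a,
  [/\ a \in J, range (L a) q & forall b, b \in J -> ~ range (L b) q ->
      side_of b q = side_of b p].
Proof.
move=> a0J; apply: contrapT => none.
have noq q a : a \in J -> range (L a) q -> exists2 b, b \in J &
    ~ range (L b) q /\ side_of b q <> side_of b p.
  move=> aJ aq; apply: contrapT => h; apply: none; exists q, a; split=> // b bJ bq.
  by apply: contrapT => bqp; apply: h; exists b.
pose B := [set q | forall b, b \in J -> ~ range (L b) q /\ side_of b q = side_of b p].
have Bp : B p.
  move=> b bJ; split=> // bp; have [c cJ [_ ]] := noq p b bJ bp; exact.
have loc q : setT q -> \forall r \near q, setT r -> (B r <-> B q).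
  move=> _; have [[a [aJ aq]]|out] := pselect (exists a, a \in J /\ range (L a) q).
    have [b bJ [bq bqp]] := noq q a aJ aq.
    near=> r => _; split=> h; last by have [] := h a aJ.
    have [br brq] : ~ range (L b) r /\ side_of b r = side_of b q.
      by near: r; apply: side_of_near.
    by case: bqp; rewrite -brq; have [] := h b bJ.
  have : \forall r \near q, forall b, b \in J -> ~ range (L b) r /\ side_of b r = side_of b q.
    apply: (@filter_forall _ _ (fun b r => b \in J -> ~ range (L b) r /\
      side_of b r = side_of b q) (nbhs q) _) => b; case: (boolP (b \in J)) => bJ; last exact: nearW.
    apply: filterS (side_of_near (i := b) (p := q) _) => [r h _ //|bq].
    by apply: out; exists b.
  apply: filterS => r h _; split=> hB b bJ; have [h1 h2] := h b bJ; have [h3 h4] := hB b bJ.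
    by split; [move=> bq; apply: out; exists b|rewrite -h2].
  by split; rewrite ?h2.
have : B (L a0 0).
  exact: (locally_constant_on_connected (@plane_connected R) loc (p := p)).
by move=> /(_ a0 a0J)[[]]; exists 0.
Unshelve. all: by end_near. Qed.

(** A boundary point of the cell of [p] may be a crossing of two curves of [J];
    then one moves away from it along one of them, to the side of the other on
    which [p] lies. *)
Lemma side_of_touched p : touched x t s (side_of^~ p).
Proof.
move=> J /set0Pn[a0 a0J]; have [q [a [aJ [u0 _ u0q] qp]]] := cell_boundary p a0J.
have neq_sym b : b != a -> a != b by rewrite eq_sym.
have [[b [bJ ba bq]]|out] := pselect (exists b, [/\ b \in J, b != a & range (L b) q]); last first.
  exists a, u0; split=> // b bJ ba; have nb : ~ range (L b) (L a u0).
    by rewrite u0q => bq; apply: out; exists b.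
  split; last by rewrite -off_curve ?neq_sym // -qp ?u0q // -u0q.
  by move=> xab; apply/eqP => e; apply: nb; apply/on_curve; rewrite ?neq_sym.
have [xab u0E] : x a b /\ u0 = t a b by apply/(on_curve (neq_sym b ba)); rewrite u0q.
have others c : c \in J -> c != a -> c != b -> ~ range (L c) (L a u0).
  move=> cJ ca cb; rewrite u0q => cq.
  apply: (no_triple (neq_sym b ba) _ (neq_sym c ca) _ bq cq); first by rewrite eq_sym.
  by exists u0.
have near_others : \forall u \near u0, forall c, c \in J -> c != a -> c != b ->
    ~ range (L c) (L a u) /\ side_of c (L a u) = side_of c p.
  apply: (@filter_forall _ _ (fun c u => c \in J -> c != a -> c != b ->
    ~ range (L c) (L a u) /\ side_of c (L a u) = side_of c p) (nbhs u0) _) => c.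
  case: (boolP [&& c \in J, c != a & c != b]); last first.
    move=> h; have all_u u : c \in J -> c != a -> c != b ->
        ~ range (L c) (L a u) /\ side_of c (L a u) = side_of c p.
      by move=> cJ ca cb; rewrite cJ ca cb in h.
    exact: nearW.
  case/and3P=> cJ ca cb; have nc := others c cJ ca cb.
  apply: (@filterS _ (nbhs u0) _ _ _ _ (@Lc a u0 _ (side_of_near nc))) => u [h1 h2] _ _ _.
  by split; rewrite ?h2 // u0q qp // -u0q.
have [u [ut hu bu]] : exists u, [/\ u != u0, (forall c, c \in J -> c != a -> c != b ->
    ~ range (L c) (L a u) /\ side_of c (L a u) = side_of c p) &
    (u0 < u) = s a b (+) side_of b p].
  case sb: (s a b (+) side_of b p).
    have [u [h ut]] : exists u, (forall c, c \in J -> c != a -> c != b ->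
      ~ range (L c) (L a u) /\ side_of c (L a u) = side_of c p) /\ u0 < u.
      apply: (@filter_ex _ u0^'+); apply: filterI; last exact: nbhs_right_gt.
      by apply: filterS near_others => u h _.
    by exists u; split=> //; rewrite gt_eqF.
  have [u [h ut]] : exists u, (forall c, c \in J -> c != a -> c != b ->
    ~ range (L c) (L a u) /\ side_of c (L a u) = side_of c p) /\ u < u0.
    apply: (@filter_ex _ u0^'-); apply: filterI; last exact: nbhs_left_lt.
    by apply: filterS near_others => u h _.
  by exists u; split=> //; [rewrite lt_eqF|rewrite ltNge (ltW ut)].
exists a, u; split=> // c cJ ca; have [cb|cb] := eqVneq c b.
  rewrite cb xab -u0E eq_sym; split=> //; rewrite /sign_on xab -u0E bu /=.
  by rewrite addbA addbb.
have [h1 h2] := hu c cJ ca cb; split; last by rewrite -off_curve ?neq_sym.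
by move=> xac; apply/eqP => e; apply: h1; apply/on_curve; rewrite ?neq_sym.
Qed.

Lemma finite_bound (f : I -> R) : exists r, forall i, f i < r.
Proof.
exists (\sum_i `|f i| + 1) => i; rewrite (bigD1 i) //=.
rewrite (le_lt_trans (ler_norm _)) // -addrA ltrDl.
by rewrite ltr_wpDl // sumr_ge0.
Qed.

Definition side_vector p : {ffun I -> bool} := [ffun b => side_of b p].

(** Outside a square that contains all crossings, and all arcs of curves between
    them, a point lies on at most one curve, and there the curve is one of its
    ends.  So the component of the sign vector in the graph of ends is locally
    constant there, and the outside of the square is connected. *)
Lemma ends_connected (C : {set {ffun I -> bool}}) :
  (forall (v : {ffun I -> bool}) e, incident x s v e -> v \in C ->
    flip_sign e v \in C) ->
  forall (v : {ffun I -> bool}) e w f,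
    incident x s v e -> incident x s w f -> v \in C -> w \in C.
Proof.
move=> Cflip.
have Cinc (v w : {ffun I -> bool}) e : incident x s v e -> incident x s w e -> v \in C -> w \in C.
  by move=> ve we vC; have [->//|->] := incident_two ve we; apply: Cflip ve vC.
have [T tT] : exists T : R, forall a b, `|t a b| < T.
  have /choice[r tr] := fun a => finite_bound (fun b => `|t a b|).
  by have [T rT] := finite_bound r; exists T => a b; apply: lt_trans (rT a).
have [rho arcs] : exists rho : R, forall a u, `|u| <= T -> `|L a u| < rho.
  have /choice[r ar] := fun a => bounded_arc T (@Lc a).
  by have [rho rrho] := finite_bound r; exists rho => a u /ar/le_lt_trans; apply.
pose W := [set p : R * R | rho < `|p|].
have farW a u : W (L a u) -> T < `|u|.
  by rewrite ltNge /W /= => h; apply/negP => /(arcs a)/(lt_trans h); rewrite ltxx.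
have end_out a u b : T < `|u| -> b != a -> ~ range (L b) (L a u).
  move=> uT ba /on_curve[|_ uE]; first by rewrite eq_sym.
  by have := lt_trans (tT a b) uT; rewrite uE ltxx.
have end_inc a u : T < `|u| -> incident x s (side_vector (L a u)) (a, 0 < u).
  move=> uT; apply/forallP => b; apply/implyP => /= ba.
  rewrite ffunE off_curve 1?eq_sym //; last exact: end_out.
  rewrite /sign_on /end_sign /=; apply/eqP; congr (_ (+) (_ && _)).
  have := lt_trans (tT a b) uT; case: (ltrP 0 u) => u0.
    by rewrite (gtr0_norm u0) => tu; rewrite (le_lt_trans (ler_norm _) tu).
  rewrite (ler0_norm u0) ltrNr => tu; apply/esym/negbTE; rewrite -leNgt ltW // (lt_le_trans tu) //.
  by rewrite lerNl -normrN ler_norm.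
have end_point e : exists2 p, W p & incident x s (side_vector p) e.
  case: e => a d; have [T' far] := pseudoline_far rho (Lp a).
  pose r := `|T| + `|T'| + 1; pose u := if d then r else - r.
  have r0 : 0 < r by rewrite ltr_wpDl // addr_ge0.
  have ur : `|u| = r by rewrite /u; case: (d); rewrite ?normrN gtr0_norm.
  have uT : T < `|u|.
    by rewrite ur (le_lt_trans (ler_norm _)) // /r -addrA ltrDl ltr_wpDl.
  have uT' : T' < `|u|.
    by rewrite ur (le_lt_trans (ler_norm _)) // /r addrAC ltrDr ltr_wpDl.
  exists (L a u); first exact: far.
  have -> : d = (0 < u); last exact: end_inc.
  by rewrite /u; case: (d); rewrite ?r0 // oppr_gt0 ltNge (ltW r0).
have locC p : W p -> \forall q \near p, W q ->
    (side_vector q \in C <-> side_vector p \in C).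
  move=> Wp; have [[a [u _ pE]]|out] := pselect (exists a, range (L a) p).
    have uT : T < `|u| by apply: (farW a); rewrite pE.
    have pinc := end_inc a u uT; rewrite pE in pinc.
    have : \forall q \near p, forall b, b != a -> side_of b q = side_of b p.
      apply: (@filter_forall _ _ (fun b q => b != a -> side_of b q = side_of b p) (nbhs p) _) => b.
      case: (boolP (b != a)) => ba; last exact: nearW.
      have bp : ~ range (L b) p by rewrite -pE; apply: end_out.
      by apply: filterS (side_of_near bp) => q [].
    apply: filterS => q qp _; have qinc : incident x s (side_vector q) (a, 0 < u).
      apply/forallP => b; apply/implyP => /= ba; rewrite ffunE qp //.
      by move/forallP/(_ b): pinc; rewrite ba /= ffunE.
    by split; apply: Cinc; eassumption.
  have : \forall q \near p, forall b, side_of b q = side_of b p.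
    apply: (@filter_forall _ _ (fun b q => side_of b q = side_of b p) (nbhs p) _) => b.
    have bp : ~ range (L b) p by move=> h; apply: out; exists b.
    by apply: filterS (side_of_near bp) => q [].
  apply: filterS => q qp _.
  by have -> : side_vector q = side_vector p by apply/ffunP => b; rewrite !ffunE.
move=> v e w f ve wf vC.
have [p Wp pe] := end_point e; have [q Wq qf] := end_point f.
have pC : side_vector p \in C := Cinc _ _ _ ve pe vC.
apply: (Cinc _ _ _ qf wf).
pose B : set (R * R) := fun p => side_vector p \in C.
have := @locally_constant_on_connected _ W B (@outside_square_connected R rho) locC p q Wp Wq.
exact.
Qed.

End Arrangement.

Lemma sides_of_arrangement_ABA_free (R : realType) (I : finType)
    (H : I -> set (R * R)) (S : seq (R * R)) : pseudohalfplane_arrangement H ->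
  exists (lt : rel (seq_sub S)) (F : {set {set seq_sub S}}),
  [/\ strict_total lt, noABA lt F &
      forall i, [set p : seq_sub S | `[< H i (val p) >]]%SET \in F :|: complements F].
Proof.
move=> [L [arr LH]].
have [x [t [s [x_irr xts]]]] := curve_traces arr LH.
have on_c i j (ij : i != j) := (xts i j ij).1.
have off_c i j (ij : i != j) := (xts i j ij).2.
have [N [rank [rank_inj zz]]] := zigzag_free_order
  (crossing_sym x_irr on_c) x_irr (crossing_inj arr x_irr on_c)
  (sign_crossing arr x_irr on_c off_c) (ends_connected arr LH on_c off_c).
apply: (lexicographic_ABA_free (sg := fun (p : seq_sub S) i => side_of H i (val p))
  (N := N) rank_inj).
have touch p := side_of_touched arr LH on_c off_c p.
by move=> p q c a b; apply: zz (touch (val p)) (touch (val q)).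
Qed.

Lemma card_le_sub (T : choiceType) (S : seq T) (A : set T) (n : nat) :
  (`I_n #<= [set` S] `&` A)%card ->
  (n <= #|[set p : seq_sub S | `[< A (val p) >]]%SET|)%N.
Proof.
case/card_leP => f.
pose e (i : 'I_n) : `I_n := exist _ (i : nat) (mem_set (ltn_ord i)).
have fP i : val (f (e i)) \in S /\ A (val (f (e i))) by exact: (set_valP (f (e i))).
pose h i : seq_sub S := SeqSub (fP i).1.
have h_inj : injective h.
  move=> i j /(congr1 val) /= /val_inj fij.
  have : e i = e j by apply: (@inj _ _ _ f) fij; rewrite inE.
  by move=> /(congr1 val) /= /val_inj.
rewrite -{1}(card_ord n) -(card_imset predT h_inj); apply/subset_leq_card/fintype.subsetP.
by move=> _ /imsetP[i _ ->]; rewrite inE; apply/asboolP; have [] := fP i.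
Qed.

(** * Polychromatic colourings for pseudohalfplanes *)

Local Open Scope card_scope.

Theorem theorem3p3 (R : realType) (k : nat) (hk : (1 <= k)%N) :
  (forall (S : set (R * R)) (I : finType) (H : I -> set (R * R)),
     finite_set S -> pseudohalfplane_arrangement H ->
     exists c : R * R -> 'I_k, forall i : I,
       `I_(2 * k - 1) #<= S `&` H i ->
       forall a : 'I_k, exists p : R * R, (S `&` H i) p /\ c p = a)
  /\
  (forall (d : Order.disp_t) (S : finOrderType d) (H : {set {set S}}),
     pseudohalfplane_hypergraph H ->
     exists c : S -> 'I_k, forall A : {set S}, A \in H ->
       (2 * k - 1 <= #|A|)%N ->
       forall a : 'I_k, exists x : S, x \in A /\ c x = a).
Proof.
case: k hk => // k _; have -> : (2 * k.+1 - 1)%N = (2 * k).+1 by lia.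
split=> [S I H /finite_seqP[s ->] arr|d S H [F [FA HF]]].
  have [lt [F [ltS FA HF]]] := sides_of_arrangement_ABA_free s arr.
  have [c cP] := polychromatic_coloring k ltS FA.
  exists (fun p => if insub p is Some q then inord (c q) else ord0) => i big a.
  have ak : (a <= k)%N by rewrite -ltnS.
  have [q qH qa] := cP _ (HF i) (card_le_sub big) a ak.
  exists (val q); split.
    by split; [exact: valP|move: qH; rewrite inE => /asboolP].
  by rewrite valK qa inord_val.
have ltS : strict_total (fun x y : S => (x < y)%O).
  split=> [x|y x z|x y]; [exact: Order.POrderTheory.ltxx|exact: Order.POrderTheory.lt_trans|].
  exact: Order.TotalTheory.lt_total.
have FA' : noABA (fun x y : S => (x < y)%O) F.
  move=> A B x y z AF BF xy yz xA xB zA zB yB; apply: contrapT => /negP yA.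
  apply: FA; exists A, B; split=> //; exists x, y, z; split=> //.
  - by rewrite !inE xA xB.
  - by rewrite !inE zA zB.
  - by rewrite !inE yA yB.
have [c cP] := polychromatic_coloring k ltS FA'.
exists (fun x => inord (c x)) => A AH big a.
have ak : (a <= k)%N by rewrite -ltnS.
have [x xA xa] := cP A (fintype.subsetP HF A AH) big a ak.
by exists x; rewrite xa inord_val.
Qed.
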